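(* Let $a,b$ be integers with $2 \le a \le 2b$ and $2 \le b \le 2a$, let $R$ be the $(a,b)$-benzel, and let $c \in \{0,1,-1\}$ with $c \equiv a+b \pmod 3$ be its class. Then the (unrescaled) Conway–Lagarias invariant of $R$ is $$I(R) = \begin{cases} (-3a^2+6ab-3b^2+a+b)/2 & \text{if } c = 0,\\ (a^2-4ab+b^2+a+b-2)/2 & \text{if } c = 1,\\ (-3a^2+6ab-3b^2-a-b+2)/2 & \text{if } c = -1.\end{cases}$$
   Context: Identify the plane with $\mathbb{C}$ and let $\omega = e^{2\pi i/3}$. For $r \in \{0,1,-1\}$ let $L_r = \{x + y\omega : x,y \in \mathbb{Z},\ x+y \equiv r \pmod 3\}$. The hexagonal grid is the graph with vertex set $L_0 \cup L_1$ and an edge between two vertices at distance $1$. Each $\alpha \in L_{-1}$ is the center of a unit hexagonal cell with corners $\alpha \pm 1, \alpha \pm \omega, \alpha \pm \omega^2$. For integers $a,b$ with $2 \le a \le 2b$ and $2 \le b \le 2a$, the $(a,b)$-benzel is the union of all unit cells lying entirely within the hexagon with vertices $a\omega+b$, $-a\omega^2-b$, $a\omega^2+b\omega$, $-a-b\omega$, $a+b\omega^2$, $-a\omega-b\omega^2$; its class is the residue of $a+b$ mod $3$ in $\{0,1,-1\}$. Conway–Lagarias invariant (Thurston's formulation). For a simply connected region $R$ that is a union of cells, let $\pi = (e_1,\dots,e_n)$ be the closed edge path traversing the boundary of $R$ once counterclockwise, starting and ending at a boundary vertex $p \in L_0$; indices are cyclic ($e_0 = e_n$, $e_{n+1} =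 e_1$). Say that a closed edge path $(e_1,\dots,e_n)$ weaves at step $i$ if $e_{i-1}$ and $e_{i+1}$ are parallel segments, and winds at step $i$ otherwise (i.e. $e_{i-1},e_i,e_{i+1}$ are consecutive edges of one hexagonal cell). A path $\pi' = (e'_1,\dots,e'_n)$ in the hexagonal grid starting at a vertex $p' \in L_0$ shadows $\pi$ if for every $1\le i\le n$, $\pi'$ weaves at step $i$ exactly when $\pi$ winds at step $i$. Such a $\pi'$ exists and is closed, and its signed area (the sum over all unit cells of the winding number of $\pi'$ around the cell) does not depend on the choices of $p$, $p'$ or $\pi'$; this signed area is $I(R)$. Equivalently, if $R$ is tiled by stones and bones, then $I(R) = 3(r - l)$, where $r$ is the number of right-pointing stones and $l$ the number of left-pointing stones; here a right-pointing stone is the union of the three cells centered at $v+1, v+\omega, v+\omega^2$ for some $v \in L_1$, a left-pointing stone is the union of the three cells centered at $v-1, v-\omega, v-\omega^2$ for some $v \in L_0$, and a bone is the union of three cells centered at $\alpha, \alpha+d, \alpha+2d$ with $\alpha \in L_{-1}$ and $d \in \{\pm(1-\omega), \pm(\omega-\omega^2), \pm(\omega^2-1)\}$.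
   Formalization: As worded, a shadow path is determined only up to reflection, which flips the sign of the signed area; the shadow is therefore also required to make the same turn as the boundary path from its first edge to its second, the choice of sign agreeing with I(R) = 3(r - l). *)

(* Defs.v *)
From HB Require Import structures.
From mathcomp Require Export all_boot all_order all_algebra.
From mathcomp Require Export complex.
From mathcomp Require Export boolp classical_sets fsbigop reals trigo.

Set Implicit Arguments.
Unset Strict Implicit.
Unset Printing Implicit Defensive.

Import Order.TTheory GRing.Theory Num.Theory.
Local Open Scope ring_scope.
Local Open Scope classical_set_scope.

(* The pair (x, y) stands for the point x + y * omega of the complex plane. *)
Definition eis := (int * int)%type.

Definition omega (R : realType) : R[i] := Complex (- (1 / 2)) (Num.sqrt 3 / 2).

Definition toC (R : realType) (z : eis) : R[i] :=
  z.1%:~R + z.2%:~R * omega R.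

(* L_r *)
Definition lattice (r : int) (z : eis) : bool := (z.1 + z.2 == r %[mod 3])%Z.

(* Multiplication by omega: omega * (x + y omega) = - y + (x - y) omega. *)
Definition mulomega (z : eis) : eis := (- z.2, z.1 - z.2).

(* |x + y omega|^2 *)
Definition sqnorm (z : eis) : int := z.1 ^+ 2 - z.1 * z.2 + z.2 ^+ 2.

Definition grid_vertex (z : eis) : bool := lattice 0 z || lattice 1 z.

Definition grid_adj (u v : eis) : bool :=
  [&& grid_vertex u, grid_vertex v & sqnorm (v - u) == 1].

Definition hull (R : realType) (s : seq R[i]) : set R[i] :=
  [set z | exists t : nat -> R,
    [/\ forall i, 0 <= t i, \sum_(i < size s) t i = 1
      & z = \sum_(i < size s) (t i)%:C%C * s`_i]].

Definition cell (R : realType) (al : eis) : set R[i] :=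
  let w := omega R in
  hull [:: toC R al + 1; toC R al - 1; toC R al + w; toC R al - w;
           toC R al + w ^+ 2; toC R al - w ^+ 2].
Arguments cell : clear implicits.

Definition benzel_hexagon (R : realType) (a b : int) : set R[i] :=
  let w := omega R in
  let A : R[i] := a%:~R in
  let B : R[i] := b%:~R in
  hull [:: A * w + B; - A * w ^+ 2 - B; A * w ^+ 2 + B * w;
           - A - B * w; A + B * w ^+ 2; - A * w - B * w ^+ 2].
Arguments benzel_hexagon : clear implicits.

(* A region is represented by the set of the centers of its cells. *)
Definition benzel (R : realType) (a b : int) : set eis :=
  [set al | lattice (-1) al /\ cell R al `<=` benzel_hexagon R a b].

(* An edge path is given by its starting vertex p and the sequence q of its
   subsequent vertices; its i-th edge (counted from 0) is the i-th element of
   [edges p q], a pair (tail, head). *)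
Definition edges (p : eis) (q : seq eis) : seq (eis * eis) := pairmap pair p q.

Definition edge_path (p : eis) (q : seq eis) : bool := path grid_adj p q.

Definition is_closed (p : eis) (q : seq eis) : bool := last p q == p.

(* Centers of the cells to the left and to the right of a directed edge:
   tail + e^(i pi/3) d and tail + e^(- i pi/3) d, where d = head - tail,
   e^(i pi/3) = 1 + omega and e^(- i pi/3) = - omega. *)
Definition left_cell (e : eis * eis) : eis :=
  e.1 + (e.2 - e.1) + mulomega (e.2 - e.1).
Definition right_cell (e : eis * eis) : eis :=
  e.1 - mulomega (e.2 - e.1).

(* The closed path (p, q) starts in L_0 and runs exactly once through each
   boundary edge of B, with B on its left. *)
Definition ccw_boundary (B : set eis) (p : eis) (q : seq eis) : Prop :=
  [/\ lattice 0 p, edge_path p q, is_closed p q, uniq (edges p q)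
    & forall e, e \in edges p q <->
        [/\ grid_adj e.1 e.2, B (left_cell e) & ~ B (right_cell e)]].

(* Cyclic indexing of the edges. *)
Definition edge_at (p : eis) (q : seq eis) (i : nat) : eis * eis :=
  nth (0, 0) (edges p q) (i %% size q).

(* The determinant of the directions of two edges in the basis (1, omega), a
   positive multiple of the Euclidean one; for edges of the grid it is 0 if
   they are parallel, and its sign tells a left turn (1) from a right turn
   (-1) when f follows e. *)
Definition turn (e f : eis * eis) : int :=
  let d := e.2 - e.1 in let d' := f.2 - f.1 in d.1 * d'.2 - d.2 * d'.1.

Definition parallel (e f : eis * eis) : bool := turn e f == 0.

(* On a path without backtracking, the three edges around a step at which the
   path does not weave are consecutive edges of one cell. *)
Definition weaves (p : eis) (q : seq eis) (i : nat) : bool :=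
  parallel (edge_at p q (i + (size q).-1)) (edge_at p q i.+1).
Definition winds (p : eis) (q : seq eis) (i : nat) : bool := ~~ weaves p q i.

(* Since all edges at a vertex have different directions, this means that no
   edge is followed (cyclically) by its reverse. *)
Definition non_backtracking (p : eis) (q : seq eis) : Prop :=
  forall i, (i < size q)%N -> ~~ parallel (edge_at p q i) (edge_at p q i.+1).

(* (p', q') shadows (p, q).  The exchange of weaving and winding determines
   the shadow only up to an isometry of the grid fixing its starting vertex,
   and the reflections among these change the sign of its signed area.  The
   condition on the first turn (from the first edge to the second one) selects
   one chirality: the one for which the invariant of a right-pointing stone is
   3 and that of a left-pointing stone is -3. *)
Definition shadows (p : eis) (q : seq eis) (p' : eis) (q' : seq eis) : Prop :=
  [/\ [/\ lattice 0 p', edge_path p' q' & size q' = size q],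
      non_backtracking p' q',
      forall i, (i < size q)%N -> weaves p' q' i = winds p q i
    & turn (edge_at p' q' 0) (edge_at p' q' 1) =
      turn (edge_at p q 0) (edge_at p q 1)].

(* Principal argument, in ]-pi, pi]. *)
Definition arg (R : realType) (z : R[i]) : R :=
  let t := acos (complex.Re z / complex.Re `|z|) in
  if 0 <= complex.Im z then t else - t.

(* Winding number of a closed polygonal path around a point off the path: the
   total variation of the argument divided by 2 pi. *)
Definition winding_number (R : realType) (p : eis) (q : seq eis) (al : eis) :
    R :=
  (\sum_(e <- edges p q)
     arg ((toC R e.2 - toC R al) / (toC R e.1 - toC R al))) / (2 * pi).

(* A sum over the infinitely many cells, of which finitely many terms are
   nonzero when the path is closed. *)
Definition signed_area (R : realType) (p : eis) (q : seq eis) : R :=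
  \sum_(al \in [set al | lattice (-1) al]) winding_number R p q al.

(* The Conway-Lagarias invariant of the region B is well defined and equal to
   v: a boundary path and a shadow of it exist, and for all choices of them the
   shadow is closed and has signed area v. *)
Definition Conway_Lagarias_invariant_is (R : realType) (B : set eis) (v : R) :
    Prop :=
  (exists p q p' q', ccw_boundary B p q /\ shadows p q p' q') /\
  (forall p q p' q', ccw_boundary B p q -> shadows p q p' q' ->
     is_closed p' q' /\ signed_area R p' q' = v).

(* Main.v *)
(* The boundary of a benzel is three times the same walk, rotated by omega each time, and a third of
   it consists of two straight zigzag sides ("arms", periods of four turns) separated by corners that
   only depend on the class.  A walk is encoded by its word of left and right turns; a shadow has the
   word in which every other turn is flipped.  By the winding number formula, the signed area of a
   closed grid path is a sum over its edges of the determinant of the two endpoints, up to a factor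
   6, hence it is additive under concatenation of words and invariant under rotations and
   translations.  Every boundary path is a cyclic shift by an even number of steps of the explicit
   one, so that the area does not depend on the choices.  In the extreme cases
   b = 2a and b = 2a - 1 and their mirror images, where the words degenerate, the benzel is also a
   benzel of class 1. *)

(* The sides of the hexagon have lengths 2b - a and 2a - b alternately, and one period of an arm
   advances by 3. Hence the parametrization 2b - a = 3m + s, 2a - b = 3n + s, with s = 2, 3, 4 for
   the classes 1, 0, -1: m and n count the periods of the two arms, and s is used up by the corners.
   An extreme case is one in which a side is shorter than s. Turns are the right encoding because a
   path weaves exactly where two consecutive turns differ, so flipping every other turn exchanges
   weaving and winding. The shadow may overlap itself, so its area is computed algebraically rather
   than by counting cells. The factor 6 is the sum of the determinants around one cell, which
   consists of six triangles of determinant 1. A third of the boundary turns by omega, but a third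
   of the shadow turns by omega^2; if that third has determinant sum kappa and displacement sigma,
   the whole shadow has determinant sum 3 kappa - |sigma|^2. *)
Require Import Defs.
From mathcomp Require Import all_boot all_order all_algebra reals trigo.
From mathcomp Require Import zify ring lra.
Import Order.TTheory GRing.Theory Num.Theory.
Local Open Scope ring_scope.

Set Implicit Arguments.
Unset Strict Implicit.
Unset Printing Implicit Defensive.

(** * Winding numbers *)

Section Argument.
Variable R : realType.
Implicit Types x y t : R.

Lemma arg_polar x y (r := Num.sqrt (x ^+ 2 + y ^+ 2)) : 0 < r ->
  [/\ x = r * cos (arg (Complex x y)), y = r * sin (arg (Complex x y)),
      0 <= y -> 0 <= arg (Complex x y) <= trigo.pi
    & y < 0 -> - trigo.pi < arg (Complex x y) < 0].
Proof.
move=> r0; have r2 : r ^+ 2 = x ^+ 2 + y ^+ 2.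
  by rewrite sqr_sqrtr // addr_ge0 // sqr_ge0.
have xr : (x / r) ^+ 2 + (y / r) ^+ 2 = 1.
  by rewrite !exprMn -mulrDl -r2 exprVn divff // sqrf_eq0 gt_eqF.
have x1 : -1 <= x / r <= 1.
  have := sqr_ge0 (y / r); set u := x / r in xr *; move: xr; nra.
have argE : arg (Complex x y) = if 0 <= y then acos (x / r) else - acos (x / r).
  by rewrite /arg normc_def.
have ysq : Num.sqrt (1 - (x / r) ^+ 2) = `|y| / r.
  by rewrite -xr addrC addKr sqrtr_sqr normrM normfV (gtr0_norm r0).
rewrite argE; case: leP => y0.
  split=> //.
  - by rewrite acosK ?in_itv //= mulrC divfK // gt_eqF.
  - by rewrite sin_acos // ysq ger0_norm // mulrC divfK // gt_eqF.
  - by move=> _; rewrite acos_ge0 ?acos_lepi.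
have yr : 0 < (y / r) ^+ 2.
  by rewrite exprn_even_gt0 //= mulf_neq0 ?invr_neq0 ?(gt_eqF r0) ?(lt_eqF y0).
have x1' : -1 < x / r < 1.
  by set u := x / r in xr x1 *; nra.
case/andP: (x1') => x1a x1b.
split=> //.
- by rewrite cosN acosK ?in_itv //= mulrC divfK // gt_eqF.
- by rewrite sinN sin_acos // ysq ltr0_norm // mulNr opprK mulrC divfK // gt_eqF.
- by move=> _; rewrite oppr_lt0 ltrN2 acos_gt0 ?acos_ltpi ?(ltW x1a) ?(ltW x1b) ?x1a ?x1b.
Qed.

Lemma arg_unique x y r t : 0 < r -> - trigo.pi < t <= trigo.pi ->
  x = r * cos t -> y = r * sin t -> arg (Complex x y) = t.
Proof.
move=> r0 /andP[t1 t2] xE yE.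
have rE : Num.sqrt (x ^+ 2 + y ^+ 2) = r.
  by rewrite xE yE !exprMn -mulrDr cos2Dsin2 mulr1 sqrtr_sqr gtr0_norm.
rewrite /arg normc_def /= rE xE [_ / r]mulrC mulKf ?gt_eqF // yE pmulr_rge0 //.
case: leP => s0.
  rewrite cosK // in_itv /= t2 andbT leNgt; apply/negP => t0.
  suff: 0 < sin (- t) by rewrite sinN oppr_gt0 ltNge s0.
  by apply: sin_gt0_pi; rewrite oppr_gt0 t0 /= ltrNl.
have t0 : t < 0.
  rewrite ltNge; apply/negP => t0.
  by move: s0; rewrite ltNge sin_ge0_pi // t0.
by rewrite cosKN ?opprK // (ltW t1) ltW.
Qed.

(** Counterclockwise crossings of the negative real axis count +1, clockwise ones -1. The axis
    itself belongs to the upper side because its principal argument is pi. *)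
Definition full_turns x1 y1 x2 y2 : int :=
  [&& y2 < 0, 0 <= y1 & 0 < x1 * y2 - y1 * x2]%:R
  - [&& y1 < 0, 0 <= y2 & x1 * y2 - y1 * x2 < 0]%:R.

(* The correction by full turns occurs when the segment from the first point to the second one
   crosses the negative real axis, where the principal argument jumps. *)
Lemma arg_div x1 y1 x2 y2 (z1 := Complex x1 y1) (z2 := Complex x2 y2) :
  0 < x1 ^+ 2 + y1 ^+ 2 -> 0 < x2 ^+ 2 + y2 ^+ 2 ->
  ~~ [&& y1 == 0, y2 == 0, x1 < 0 & 0 < x2] ->
  ((0 <= y1) == (0 <= y2)) || (x1 * y2 - y1 * x2 != 0) ->
  arg (z2 / z1) = arg z2 - arg z1 + 2 * trigo.pi * (full_turns x1 y1 x2 y2)%:~R.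
Proof.
move=> n1 n2 nopp ncross.
set r1 := Num.sqrt (x1 ^+ 2 + y1 ^+ 2); set r2 := Num.sqrt (x2 ^+ 2 + y2 ^+ 2).
have r1_gt0 : 0 < r1 by rewrite sqrtr_gt0.
have r2_gt0 : 0 < r2 by rewrite sqrtr_gt0.
have [xE1 yE1 up1 dn1] := arg_polar r1_gt0.
have [xE2 yE2 up2 dn2] := arg_polar r2_gt0.
rewrite -/z1 -/r1 in xE1 yE1 up1 dn1; rewrite -/z2 -/r2 in xE2 yE2 up2 dn2.
set t1 := arg z1 in xE1 yE1 up1 dn1 *; set t2 := arg z2 in xE2 yE2 up2 dn2 *.
have pi0 := trigo.pi_gt0 R.
have crossE : x1 * y2 - y1 * x2 = r1 * r2 * sin (t2 - t1).
  by rewrite sinB {1}xE1 {1}yE1 {1}xE2 {1}yE2; ring.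
have r12 : 0 < r1 * r2 by rewrite mulr_gt0.
have cross_lt0 : (x1 * y2 - y1 * x2 < 0) = (sin (t2 - t1) < 0) by rewrite crossE pmulr_rlt0.
have cross_gt0 : (0 < x1 * y2 - y1 * x2) = (0 < sin (t2 - t1)) by rewrite crossE pmulr_rgt0.
have cross_eq0 : (x1 * y2 - y1 * x2 == 0) = (sin (t2 - t1) == 0).
  by rewrite crossE mulf_eq0 (gt_eqF r12).
have divE : z2 / z1 = Complex (r2 / r1 * cos (t2 - t1)) (r2 / r1 * sin (t2 - t1)).
  have r1sq : x1 ^+ 2 + y1 ^+ 2 = r1 ^+ 2 by rewrite sqr_sqrtr // ltW.
  have r1n0 : r1 != 0 by rewrite gt_eqF.
  apply/eqP; rewrite eq_complex /= r1sq; apply/andP; split; apply/eqP.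
    by rewrite cosB {1}xE1 {1}yE1 {1}xE2 {1}yE2; field.
  by rewrite sinB {1}xE1 {1}yE1 {1}xE2 {1}yE2; field.
rewrite divE; set k := full_turns _ _ _ _.
have periodk : cos (t2 - t1 + 2 * trigo.pi * k%:~R) = cos (t2 - t1) /\
               sin (t2 - t1 + 2 * trigo.pi * k%:~R) = sin (t2 - t1).
  have -> : 2 * trigo.pi = trigo.pi *+ 2 :> R by rewrite mulr_natl.
  rewrite /k /full_turns; case: [&& _, _ & _]; case: [&& _, _ & _];
    rewrite ?subrr ?sub0r ?subr0 ?mulr0 ?addr0 ?mulr1 ?mulrN1 //=.
  - by rewrite cosD2pi sinD2pi.
  - by split; [rewrite -[LHS]cosD2pi|rewrite -[LHS]sinD2pi]; rewrite subrK.
(* The right-hand side is an angle of z2 / z1, so only its membership in ]-pi, pi] remains. The sign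
   of sin (t2 - t1), which is that of the determinant, tells on which side of -pi or pi the
   difference lies. *)
apply: (arg_unique (r := r2 / r1)); rewrite ?periodk.1 ?periodk.2 // ?divr_gt0 //.
have sin_neg t : - trigo.pi <= t <= 0 -> sin t <= 0.
  by move=> /andP[h1 h2]; rewrite -oppr_ge0 -sinN sin_ge0_pi // oppr_ge0 h2 lerNl.
have sin_per t : sin (t + trigo.pi *+ 2) = sin t by exact: sinD2pi.
rewrite {periodk}/k /full_turns cross_gt0 cross_lt0; move: nopp ncross; rewrite cross_eq0.
have [y10|y10] := leP 0 y1; have [y20|y20] := leP 0 y2 => /=.
- move=> nopp _; rewrite subrr mulr0 addr0.
  have /andP[a1 b1] := up1 y10; have /andP[a2 b2] := up2 y20.
  apply/andP; split; last by clear -pi0 a1 b1 a2 b2; lra.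
  rewrite lt_neqAle; apply/andP; split; last by clear -pi0 a1 b1 a2 b2; lra.
  (* A difference of -pi within the closed upper half-plane forces arguments pi and 0, the opposite
     position excluded by [nopp]. *)
  apply/negP => /eqP e; have e1 : t1 = trigo.pi by clear -pi0 a1 b1 a2 b2 e; lra.
  have e2 : t2 = 0 by clear -pi0 a1 b1 a2 b2 e; lra.
  move: nopp; rewrite xE1 yE1 xE2 yE2 e1 e2 sinpi sin0 cospi cos0 !mulr0 eqxx /=.
  by rewrite mulr1 mulrN1 oppr_lt0 r1_gt0 r2_gt0.
- move=> _ sn0; have /andP[a1 b1] := up1 y10; have /andP[a2 b2] := dn2 y20.
  case: (ltgtP 0 (sin (t2 - t1))) sn0 => // s _; rewrite ?subrr ?subr0 ?mulr0 ?mulr1 ?addr0.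
  + have : t2 - t1 < - trigo.pi.
      rewrite ltNge; apply/negP => h; suff : sin (t2 - t1) <= 0 by rewrite leNgt s.
      by apply: sin_neg; clear -pi0 a1 b1 a2 b2 h; apply/andP; split; lra.
    by clear -pi0 a1 b1 a2 b2 => h; apply/andP; split; lra.
  + have : - trigo.pi < t2 - t1.
      rewrite ltNge; apply/negP => h; suff : 0 <= sin (t2 - t1) by rewrite leNgt s.
      rewrite -sin_per; apply: sin_ge0_pi; rewrite -mulr_natl.
      by clear -pi0 a1 b1 a2 b2 h; apply/andP; split; lra.
    by clear -pi0 a1 b1 a2 b2 => h; apply/andP; split; lra.
- move=> _ sn0; have /andP[a1 b1] := dn1 y10; have /andP[a2 b2] := up2 y20.
  case: (ltgtP 0 (sin (t2 - t1))) sn0 => // s _; rewrite ?subrr ?sub0r ?mulr0 ?mulrN1 ?addr0.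
  + have : t2 - t1 < trigo.pi.
      rewrite ltNge; apply/negP => h; suff : sin (t2 - t1) <= 0 by rewrite leNgt s.
      have -> : t2 - t1 = (t2 - t1 - 2 * trigo.pi) + trigo.pi *+ 2 by rewrite -mulr_natl; ring.
      by rewrite sin_per; apply: sin_neg; clear -pi0 a1 b1 a2 b2 h; apply/andP; split; lra.
    by clear -pi0 a1 b1 a2 b2 => h; apply/andP; split; lra.
  + have : trigo.pi < t2 - t1.
      rewrite ltNge; apply/negP => h; suff : 0 <= sin (t2 - t1) by rewrite leNgt s.
      by apply: sin_ge0_pi; clear -pi0 a1 b1 a2 b2 h; apply/andP; split; lra.
    by clear -pi0 a1 b1 a2 b2 => h; apply/andP; split; lra.
- move=> _ _; rewrite subrr mulr0 addr0.
  have /andP[a1 b1] := dn1 y10; have /andP[a2 b2] := dn2 y20.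
  by clear -pi0 a1 b1 a2 b2; apply/andP; split; lra.
Qed.
End Argument.

(** * Winding numbers as signed counts of ray crossings *)

Definition cross (u v : eis) : int := u.1 * v.2 - u.2 * v.1.

(** The ray starts at [al] in the direction -1, where the argument jumps. An edge changes the row by
    at most one, so only edges between the row of [al] and the one below can cross it. *)
Definition ray_crossings (al : eis) (e : eis * eis) : int :=
  let u := e.1 - al in let v := e.2 - al in
  [&& u.2 == 0, v.2 == -1 & u.1 < 0]%:R - [&& u.2 == -1, v.2 == 0 & v.1 < 0]%:R.

(** Among the six units, the edges leaving L_0 are 1, omega, omega^2 and those leaving L_1 are their
    opposites. This makes adjacency a linear case distinction. *)
Lemma grid_adjP (x y x' y' : int) :
  reflect (exists q,
      x + y = 3 * q /\
        (x' = x + 1 /\ y' = y \/ x' = x /\ y' = y + 1 \/ x' = x - 1 /\ y' = y - 1)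
      \/ x + y = 3 * q + 1 /\
        (x' = x - 1 /\ y' = y \/ x' = x /\ y' = y - 1 \/ x' = x + 1 /\ y' = y + 1))
    (grid_adj (x, y) (x', y')).
Proof.
rewrite /grid_adj /grid_vertex /lattice /sqnorm /=.
apply: (iffP and3P) => [[h1 h2 /eqP h3]|[q]].
  exists ((x + y) %/ 3)%Z.
  move: h3; set u := x' - x; set v := y' - y => h3.
  have [u1 v1] : -1 <= u <= 1 /\ -1 <= v <= 1 by split; nia.
  have hu : u = 1 \/ u = 0 \/ u = -1 by lia.
  have hv : v = 1 \/ v = 0 \/ v = -1 by lia.
  have {u1 v1 hu hv} : u = 1 /\ v = 0 \/ u = 0 /\ v = 1 \/ u = -1 /\ v = -1 \/
      u = -1 /\ v = 0 \/ u = 0 /\ v = -1 \/ u = 1 /\ v = 1.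
    by case: hu h3 => [->|[->|->]]; case: hv => [->|[->|->]]; lia.
  by rewrite /u /v; move: h1 h2; clear; lia.
by case=> -[h [|[|]]] [-> ->]; split; by [clear -h; lia | apply/eqP; ring].
Qed.

Lemma sum_edges (V : zmodType) (f : eis -> V) p q :
  \sum_(e <- edges p q) (f e.2 - f e.1) = f (last p q) - f p.
Proof.
elim: q p => [|v q IH] p /=; first by rewrite big_nil subrr.
by rewrite big_cons /= IH addrC addrA subrK.
Qed.

Lemma edge_path_adj p q : edge_path p q -> {in edges p q, forall e, grid_adj e.1 e.2}.
Proof.
elim: q p => [|v q IH] p //= /andP[pv vq] e; rewrite inE => /predU1P[-> //|].
exact: IH.
Qed.

Section WindingNumber.
Variable R : realType.

Lemma toCE (u : eis) :
  toC R u = Complex (u.1%:~R - u.2%:~R / 2) (Num.sqrt 3 / 2 * u.2%:~R).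
Proof.
rewrite /toC /omega -!(rmorph_int (@real_complex R)).
apply/eqP; rewrite eq_complex /=; apply/andP; split; apply/eqP; ring.
Qed.

Lemma toCB (u v : eis) : toC R u - toC R v = toC R (u - v).
Proof. by rewrite /toC !rmorphB /=; ring. Qed.

Lemma arg_edge (al : eis) (e : eis * eis) : lattice (-1) al -> grid_adj e.1 e.2 ->
  arg ((toC R e.2 - toC R al) / (toC R e.1 - toC R al)) =
  arg (toC R e.2 - toC R al) - arg (toC R e.1 - toC R al)
    + 2 * trigo.pi * (ray_crossings al e)%:~R.
Proof.
case: al e => [a b] [[x y] [x' y']] /= hal /grid_adjP hadj.
rewrite !toCB !toCE /ray_crossings /=.
set X := x - a; set Y := y - b; set X' := x' - a; set Y' := y' - b.
(* Subtracting a point of L_{-1} turns the residues 0 and 1 of the endpoints into 1 and 2; in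
   particular no endpoint becomes the origin. *)
have [q h] : exists q, X + Y = 3 * q + 1 /\
    (X' = X + 1 /\ Y' = Y \/ X' = X /\ Y' = Y + 1 \/ X' = X - 1 /\ Y' = Y - 1)
  \/ X + Y = 3 * q + 2 /\
    (X' = X - 1 /\ Y' = Y \/ X' = X /\ Y' = Y - 1 \/ X' = X + 1 /\ Y' = Y + 1).
  case: hadj => q h; exists ((X + Y) %/ 3)%Z; rewrite /X /Y /X' /Y'.
  by move: hal h; rewrite /lattice /=; clear; lia.
move: X Y X' Y' h => {hal hadj x y x' y' a b} X Y X' Y' h.
pose s : R := Num.sqrt 3 / 2.
have s0 : 0 < s by rewrite divr_gt0 // sqrtr_gt0.
rewrite -/s; clearbody s.
have nz (U V : int) : (U != 0) || (V != 0) ->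
    0 < (U%:~R - V%:~R / 2) ^+ 2 + (s * V%:~R) ^+ 2.
  move=> UV; rewrite lt_neqAle addr_ge0 ?sqr_ge0 // andbT eq_sym paddr_eq0 ?sqr_ge0 //.
  rewrite !sqrf_eq0 mulf_eq0 (gt_eqF s0) /= intr_eq0.
  case: (V =P 0) UV => [->|_] /=; last by rewrite andbF.
  by rewrite orbF mul0r subr0 intr_eq0 andbT.
have sgn (V : int) : (0 <= s * V%:~R) = (0 <= V) by rewrite pmulr_rge0 // ler0z.
have sgn' (V : int) : (s * V%:~R < 0) = (V < 0) by rewrite pmulr_rlt0 // ltrz0.
have crossE : (X%:~R - Y%:~R / 2) * (s * Y'%:~R) - s * Y%:~R * (X'%:~R - Y'%:~R / 2) =
    s * (X * Y' - Y * X')%:~R.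
  by rewrite rmorphB !rmorphM /=; ring.
rewrite arg_div.
- rewrite /full_turns crossE !sgn !sgn' pmulr_rgt0 // ltr0z.
  congr (_ + _ * _%:~R); congr (_%:R - _%:R); congr nat_of_bool.
    by clear -h; case: h => -[h [|[|]]] [-> ->]; apply/idP/idP; lia.
  by clear -h; case: h => -[h [|[|]]] [-> ->]; apply/idP/idP; lia.
- by apply: nz; clear -h; lia.
- by apply: nz; clear -h; lia.
- rewrite !mulf_eq0 (gt_eqF s0) /= !intr_eq0.
  apply/negP => /and4P[/eqP Y0 /eqP Y'0]; rewrite Y0 Y'0 !mul0r !subr0 ltrz0 ltr0z.
  by clear -h Y0 Y'0; lia.
- rewrite !sgn crossE mulf_eq0 (gt_eqF s0) /= intr_eq0.
  by clear -h; case: h => -[h [|[|]]] [-> ->]; lia.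
Qed.

(** Around a closed path the differences of arguments telescope, and only the full turns survive. *)
Lemma winding_numberE p q al : lattice (-1) al -> edge_path p q -> is_closed p q ->
  winding_number R p q al = (\sum_(e <- edges p q) ray_crossings al e)%:~R.
Proof.
move=> hal pq /eqP cl; rewrite /winding_number.
pose f v := arg (toC R v - toC R al).
have -> : \sum_(e <- edges p q)
      arg ((toC R e.2 - toC R al) / (toC R e.1 - toC R al)) =
    \sum_(e <- edges p q)
      ((f e.2 - f e.1) + 2 * trigo.pi * (ray_crossings al e)%:~R).
  by apply: eq_big_seq => e /(edge_path_adj pq) he; rewrite arg_edge.
rewrite big_split /= sum_edges cl subrr add0r -mulr_sumr -rmorph_sum /= mulrC mulKf //.
by rewrite mulf_neq0 // gt_eqF // trigo.pi_gt0.
Qed.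

End WindingNumber.

(** * Signed areas *)

(** L_{-1} is parametrized by the row y and by k = (x + y + 1) / 3, both in [-n, n[; the cells of a
    row whose ray meets a given edge then form an interval of values of k. *)
Definition box (n : nat) : seq eis :=
  [seq (3 * (j%:Z - n%:Z) - 1 - (i%:Z - n%:Z), i%:Z - n%:Z)
     | i <- index_iota 0 (2 * n), j <- index_iota 0 (2 * n)].

Lemma box_uniq n : uniq (box n).
Proof.
apply: allpairs_uniq; rewrite ?iota_uniq // => -[i j] [i' j'] _ _ [] /= e1 e2.
by congr (_, _); lia.
Qed.

Lemma mem_box n (x y : int) : lattice (-1) (x, y) ->
  ((x, y) \in box n) = [&& - n%:Z <= y, y < n%:Z, - (3 * n%:Z) <= x + y + 1
    & x + y + 1 < 3 * n%:Z].
Proof.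
rewrite /lattice /= => hal; apply/allpairsP/and4P => [[[i j] /=]|[h1 h2 h3 h4]].
  by rewrite !mem_index_iota => -[hi hj [-> ->]]; clear hal; split; lia.
exists (absz (y + n%:Z), absz (((x + y + 1) %/ 3)%Z + n%:Z)).
rewrite /= !mem_index_iota; split; [lia|lia|congr (_, _)]; clear -h1 h2 h3 h4 hal; lia.
Qed.

Lemma sum_leq (c n : nat) : (c <= n)%N -> \sum_(0 <= j < n) (c <= j)%:R = n%:Z - c%:Z.
Proof.
elim: n => [|n IH] cn; first by rewrite big_nil; lia.
rewrite big_nat_recr //=; case: (leqP c n) => h; first by rewrite IH //; lia.
rewrite big_nat big1 => [|j /andP[_ hj]]; first by rewrite /= add0r; lia.
by rewrite (_ : (c <= j)%N = false) //; lia.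
Qed.

Lemma ray_crossings_rev al u v : ray_crossings al (u, v) = - ray_crossings al (v, u).
Proof.
by rewrite /ray_crossings opprB; congr (_%:R - _%:R); rewrite /= andbCA.
Qed.

Lemma ray_crossings0 (a b x y x' y' : int) : ~ (y = b /\ y' = b - 1 /\ x < a) ->
  ~ (y = b - 1 /\ y' = b /\ x' < a) -> ray_crossings (a, b) ((x, y), (x', y')) = 0.
Proof.
move=> h h'; rewrite /ray_crossings /=.
case: and3P => [[h1 h2 h3]|_]; first by case: h; lia.
by case: and3P => [[h1 h2 h3]|_] //; case: h'; lia.
Qed.

Lemma ray_crossings_far (a b x y x' y' : int) : grid_adj (x, y) (x', y') ->
  (y = b -> x < a) -> (y' = b -> x' < a) ->
  ray_crossings (a, b) ((x, y), (x', y')) = (b <= y)%R%:R - (b <= y')%R%:R.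
Proof.
move=> /grid_adjP[q hq]; rewrite /ray_crossings /=.
have : y' = y \/ y' = y - 1 \/ y' = y + 1 by clear -hq; lia.
by move=> {hq} [->|[->|->]]; clear; lia.
Qed.

(** A cell far to the right has its ray crossed by every edge between its row and the one below, so
    its crossings are differences of an indicator of the rows and telescope. The rays of the other
    cells outside the box meet no edge. *)
Lemma signed_area_outside_box n p q al : edge_path p q -> is_closed p q ->
  {in edges p q, forall e, `|e.1.1| + `|e.1.2| < n%:Z /\ `|e.2.1| + `|e.2.2| < n%:Z} ->
  lattice (-1) al -> al \notin box n -> \sum_(e <- edges p q) ray_crossings al e = 0.
Proof.
case: al => a b pq cl hn hal; rewrite mem_box // => out.
have hadj := edge_path_adj pq.
case: (boolP (3 * n%:Z <= a + b + 1)) => ha; last first.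
  rewrite big_seq big1 // => -[[x y] [x' y']] he; have [/= h1 h2] := hn _ he.
  have /grid_adjP[k h] := hadj _ he.
  by move: hal; rewrite /lattice /= => hal; apply: ray_crossings0;
    clear -ha hal h out h1 h2; lia.
pose f (v : eis) : int := - (b <= v.2)%R%:R.
transitivity (\sum_(e <- edges p q) (f e.2 - f e.1)).
  apply: eq_big_seq => -[[x y] [x' y']] he; have [/= h1 h2] := hn _ he.
  rewrite ray_crossings_far ?(hadj _ he) /f /= ?opprK 1?addrC //.
    by clear -ha h1; lia.
  by clear -ha h2; lia.
by rewrite sum_edges (eqP cl) subrr.
Qed.

(** The edge crosses the rays of the cells to its right in row y, namely those with k from (x + y) /
    3 + 1 (rounded down) to n - 1. *)
Lemma sum_box_descending n (x y x' y' : int) : y' = y - 1 -> `|x| + `|y| < n%:Z ->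
  grid_adj (x, y) (x', y') ->
  \sum_(al <- box n) ray_crossings al ((x, y), (x', y')) = n%:Z - 1 - ((x + y) %/ 3)%Z.
Proof.
move=> -> xyn /grid_adjP[q hq].
have [k0 k1] : - n%:Z <= ((x + y) %/ 3)%Z + 1 /\ ((x + y) %/ 3)%Z + 1 <= n%:Z by lia.
pose c := absz (((x + y) %/ 3)%Z + 1 + n%:Z).
rewrite /box big_allpairs_dep /=.
have termE (i j : nat) : ray_crossings (3 * (j%:Z - n%:Z) - 1 - (i%:Z - n%:Z), i%:Z - n%:Z)
      ((x, y), (x', y - 1)) =
    (i == absz (y + n%:Z))%:R * (c <= j)%N%:R.
  rewrite /ray_crossings -natrM mulnb /=.
  have -> : [&& y - (i%:Z - n%:Z) == -1, y - 1 - (i%:Z - n%:Z) == 0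
      & x' - (3 * (j%:Z - n%:Z) - 1 - (i%:Z - n%:Z)) < 0] = false by clear; lia.
  rewrite subr0.
  by congr (nat_of_bool _)%:R; rewrite /c; clear -hq xyn; apply/idP/idP; lia.
under eq_bigr => i _ do under eq_bigr => j _ do rewrite termE.
have -> : n%:Z - 1 - ((x + y) %/ 3)%Z =
    (2 * n)%N%:Z - c%:Z by rewrite /c; lia.
have cn : (c <= 2 * n)%N by rewrite /c; clear -k0 k1; lia.
under eq_bigr do rewrite -mulr_sumr (sum_leq cn).
rewrite -mulr_suml (bigD1_seq (absz (y + n%:Z))) ?iota_uniq ?mem_index_iota //=; last first.
  by clear -xyn; lia.
by rewrite eqxx big1 ?addr0 ?mul1r // => i /negPf ->.
Qed.

(* Six times the number of cells of the box that an edge contributes is the determinant of its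
   endpoints up to this potential, which disappears along a closed path. *)
Definition potential (n : nat) (v : eis) : int :=
  v.1 * v.2 + v.2 ^+ 2 + v.1 - (lattice 1 v)%:R - 6 * (n%:Z - 1) * v.2.

(** Horizontal edges cross no ray, and ascending edges are reversed descending ones. *)
Lemma sum_box_edge n (u v : eis) : grid_adj u v ->
  `|u.1| + `|u.2| < n%:Z -> `|v.1| + `|v.2| < n%:Z ->
  6 * \sum_(al <- box n) ray_crossings al (u, v) =
  cross u v + (potential n v - potential n u).
Proof.
case: u v => [x y] [x' y'] /= huv xyn xyn'.
have gridC : grid_adj (x', y') (x, y).
  move: huv; rewrite /grid_adj /sqnorm /= => /and3P[-> -> /eqP h].
  by apply/eqP; rewrite -h; ring.
have hq := grid_adjP _ _ _ _ huv; have hq' := grid_adjP _ _ _ _ gridC.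
have : y' = y \/ y' = y - 1 \/ y = y' - 1 by clear -hq; case: hq => q; lia.
rewrite /cross /potential /lattice /=; case=> [yE|[yE|yE]].
- rewrite big1 => [|[a b] _]; last by apply: ray_crossings0; rewrite yE; clear; lia.
  case: hq => q h.
  have [[x'E [-> ->]]|[x'E [-> ->]]] :
      x' = x + 1 /\ (x + y == 1 %[mod 3])%Z = false /\ (x' + y' == 1 %[mod 3])%Z = true
      \/ x' = x - 1 /\ (x + y == 1 %[mod 3])%Z = true /\ (x' + y' == 1 %[mod 3])%Z = false.
    by clear -h yE; case: h => -[h h']; [left|right]; lia.
    by rewrite x'E yE /=; ring.
  by rewrite x'E yE /=; ring.
- rewrite sum_box_descending //; case: hq => q h.
  have -> : ((x + y) %/ 3)%Z = q by clear -h; lia.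
  have [[xE [x'E [-> ->]]]|[xE [x'E [-> ->]]]] :
      x = 3 * q - y /\ x' = x - 1 /\
        (x + y == 1 %[mod 3])%Z = false /\ (x' + y' == 1 %[mod 3])%Z = true
      \/ x = 3 * q + 1 - y /\ x' = x /\
        (x + y == 1 %[mod 3])%Z = true /\ (x' + y' == 1 %[mod 3])%Z = false.
    by clear -h yE; case: h => -[h h']; [left|right]; lia.
    by rewrite x'E yE xE /=; ring.
  by rewrite x'E yE xE /=; ring.
under eq_bigr do rewrite ray_crossings_rev.
rewrite sumrN sum_box_descending //; case: hq' => q h.
have -> : ((x' + y') %/ 3)%Z = q by clear -h; lia.
have [[xE [x'E [-> ->]]]|[xE [x'E [-> ->]]]] :
    x' = 3 * q - y' /\ x = x' - 1 /\
      (x' + y' == 1 %[mod 3])%Z = false /\ (x + y == 1 %[mod 3])%Z = true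
    \/ x' = 3 * q + 1 - y' /\ x = x' /\
      (x' + y' == 1 %[mod 3])%Z = true /\ (x + y == 1 %[mod 3])%Z = false.
  by clear -h yE; case: h => -[h h']; [left|right]; lia.
  by rewrite x'E yE xE /=; ring.
by rewrite x'E yE xE /=; ring.
Qed.

Lemma path_bound p q : exists n : nat,
  {in edges p q, forall e, `|e.1.1| + `|e.1.2| < n%:Z /\ `|e.2.1| + `|e.2.2| < n%:Z}.
Proof.
elim: q p => [|v q IH] p; first by exists 0%N.
have [n hn] := IH v.
pose m (u : eis) := (absz u.1 + absz u.2)%N.
have mE (u : eis) : `|u.1| + `|u.2| = (m u)%:Z by rewrite /m PoszD !abszE.
exists (n + m p + m v).+1 => e /=; rewrite inE => /predU1P[-> /=|/hn].
  by rewrite !mE; split; lia.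
by rewrite !mE; clear; lia.
Qed.

(** Winding numbers vanish outside a large box; exchanging the sums over its cells and over the
    edges leaves the determinants and a telescoping potential. *)
Lemma signed_areaE (R : realType) p q (A : int) : edge_path p q -> is_closed p q ->
  \sum_(e <- edges p q) cross e.1 e.2 = 6 * A -> signed_area R p q = A%:~R.
Proof.
move=> pq cl areaE; have [n hn] := path_bound p q.
rewrite /signed_area.
have box_lattice : {in box n, forall al, lattice (-1) al}.
  by move=> al /allpairsP[[i j] /= [_ _ ->]]; rewrite /lattice /=; clear; lia.
rewrite -(@fsbig_widen _ _ _ _ [set` box n]%classic); first last.
- move=> al [/= hal /negP out].
  by rewrite winding_numberE // (signed_area_outside_box pq cl hn hal out).
- by move=> al /= /box_lattice.
rewrite -fsbig_seq ?box_uniq //.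
have -> : \sum_(al <- box n) winding_number R p q al =
    (\sum_(al <- box n) \sum_(e <- edges p q) ray_crossings al e)%:~R.
  rewrite rmorph_sum; apply: eq_big_seq => al /box_lattice hal /=.
  by rewrite winding_numberE.
congr (_%:~R); apply: (@mulfI _ 6) => //.
rewrite -areaE exchange_big mulr_sumr /=.
transitivity (\sum_(e <- edges p q)
    (cross e.1 e.2 + (potential n e.2 - potential n e.1))).
  apply: eq_big_seq => -[u v] he; have [h1 h2] := hn _ he.
  by rewrite sum_box_edge //; exact: edge_path_adj he.
by rewrite big_split /= sum_edges (eqP cl) subrr addr0.
Qed.

(** * Boundary walks and their shadows *)

(* The grid edge that follows [e] after a left ([true]) or right ([false]) turn. *)
Definition step (t : bool) (e : eis * eis) : eis * eis :=
  let d := e.2 - e.1 in (e.2, e.2 + (if t then d + mulomega d else - mulomega d)).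

(** The last turn leads to an edge that is not listed, so that a closed walk has as many turns as
    edges. *)
Fixpoint walk (e : eis * eis) (w : seq bool) : seq (eis * eis) :=
  if w is t :: w' then e :: walk (step t e) w' else [::].

Definition walk_end (e : eis * eis) (w : seq bool) := foldl (fun e t => step t e) e w.

(* [alternate false] exchanges weaving and winding: it changes every other turn. *)
Fixpoint alternate (b : bool) (w : seq bool) : seq bool :=
  if w is t :: w' then (t (+) b) :: alternate (~~ b) w' else [::].

Lemma size_walk e w : size (walk e w) = size w.
Proof. by elim: w e => //= t w IH e; rewrite IH. Qed.

Lemma walk_cat e w1 w2 : walk e (w1 ++ w2) = walk e w1 ++ walk (walk_end e w1) w2.
Proof. by elim: w1 e => //= t w IH e; rewrite IH. Qed.

Lemma walk_end_cat e w1 w2 : walk_end e (w1 ++ w2) = walk_end (walk_end e w1) w2.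
Proof. exact: foldl_cat. Qed.

Lemma nth_walk e w i : (i < size w)%N ->
  nth (0, 0) (walk e w) i = walk_end e (take i w).
Proof. by elim: w e i => //= t w IH e [|i] //= hi; rewrite IH. Qed.

Lemma edges_walk e w : edges e.1 (map snd (walk e w)) = walk e w.
Proof.
elim: w e => //= t w IH [u v] /=; congr (_ :: _).
by rewrite -[RHS]IH.
Qed.

Lemma last_walk e w : last e.1 (map snd (walk e w)) = (walk_end e w).1.
Proof. by elim: w e => //= t w IH [u v] /=; rewrite -IH. Qed.

Lemma size_edges p q : size (edges p q) = size q.
Proof. exact: size_pairmap. Qed.

Lemma map_snd_edges p q : map snd (edges p q) = q.
Proof. by elim: q p => //= v q IH p; rewrite IH. Qed.

Lemma edges_linked p q i : (i.+1 < size q)%N ->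
  (nth (0, 0) (edges p q) i.+1).1 = (nth (0, 0) (edges p q) i).2.
Proof. by elim: q p i => [|v [|u q] IH] p [|i] //= hi; exact: (IH v i). Qed.

Lemma size_alternate b w : size (alternate b w) = size w.
Proof. by elim: w b => //= t w IH b; rewrite IH. Qed.

Lemma alternate_cat b w1 w2 :
  alternate b (w1 ++ w2) = alternate b w1 ++ alternate (b (+) odd (size w1)) w2.
Proof.
elim: w1 b => [|t w IH] b /=; first by rewrite addbF.
by rewrite IH addNb addbN.
Qed.

Lemma nth_alternate b w i : (i < size w)%N ->
  nth false (alternate b w) i = nth false w i (+) b (+) odd i.
Proof.
elim: w b i => //= t w IH b [|i] /= hi; first by rewrite addbF.
by rewrite IH // addbN addNb addbN.
Qed.

Definition adj_edge (e : eis * eis) : bool := grid_adj e.1 e.2.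

Lemma step_adj t e : adj_edge e -> adj_edge (step t e).
Proof.
case: e => -[x y] [x' y'] /grid_adjP[q hq]; rewrite /adj_edge /step /mulomega /=.
by case: t; apply/grid_adjP => /=; exists ((x' + y') %/ 3)%Z; lia.
Qed.

Lemma edge_path_walk e w : adj_edge e -> edge_path e.1 (map snd (walk e w)).
Proof.
elim: w e => //= t w IH [u v] /= huv; have := IH _ (step_adj t huv).
by rewrite /edge_path /= => ->; rewrite andbT.
Qed.

Lemma step_surj t e : adj_edge e -> exists2 e', adj_edge e' & step t e' = e.
Proof.
case: e => -[x y] [x' y'] /grid_adjP[q hq].
case: t.
  exists ((x - (y' - y), y - (y' - y - (x' - x))), (x, y)).
    by apply/grid_adjP; exists ((x - (y' - y) + (y - (y' - y - (x' - x)))) %/ 3)%Z; clear -hq; lia.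
  by congr (_, (_, _)) => /=; ring.
exists ((x - (x' - x - (y' - y)), y - (x' - x)), (x, y)).
  by apply/grid_adjP; exists ((x - (x' - x - (y' - y)) + (y - (x' - x))) %/ 3)%Z; clear -hq; lia.
by congr (_, (_, _)) => /=; ring.
Qed.

(** Walks can be prolonged backwards: this relocates a shadow that starts in the middle of the
    reference word. *)
Lemma walk_end_surj w e : adj_edge e -> exists2 e', adj_edge e' & walk_end e' w = e.
Proof.
elim: w e => [|t w IH] e he; first by exists e.
have [e1 /(step_surj t)[e2 h2 <-] <-] := IH e he.
by exists e2.
Qed.

Lemma turn_step t e : adj_edge e -> turn e (step t e) = if t then 1 else -1.
Proof.
case: e => -[x y] [x' y'] /grid_adjP[q hq]; rewrite /turn /step /mulomega /=.
by case: t => /=; clear -hq; case: hq => -[h [|[|]]] [-> ->]; ring.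
Qed.

(** Opposite turns of 60 degrees cancel, whereas equal ones add up to 120 degrees. *)
Lemma parallel_step2 s t e : adj_edge e -> parallel e (step t (step s e)) = (s != t).
Proof.
case: e => -[x y] [x' y'] /grid_adjP[q hq]; rewrite /parallel /turn /step /mulomega /=.
case: s; case: t => /=; clear -hq; apply/eqP;
  case: hq => -[h [|[|]]] [-> ->]; lia.
Qed.

(** Vertices have degree three: besides going back there are only the two turns. *)
Lemma adj_edge_succ e f : adj_edge e -> adj_edge f -> f.1 = e.2 ->
  [\/ f = step true e, f = step false e | f = (e.2, e.1)].
Proof.
case: e f => [[x y] [x' y']] [u [x'' y'']] /grid_adjP[q hq] + /= uE.
rewrite uE => /grid_adjP[k hk]; rewrite /step /mulomega /=.
have : x'' = x' + (x' - x - (y' - y)) /\ y'' = y' + (y' - y + (x' - x - (y' - y))) \/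
  x'' = x' + (y' - y) /\ y'' = y' - (x' - x - (y' - y)) \/ x'' = x /\ y'' = y.
  by clear -hq hk; lia.
case=> [[-> ->]|[[-> ->]|[-> ->]]]; [constructor 1|constructor 2|constructor 3] => //.
by congr (_, (_, _)); rewrite /= ?opprK.
Qed.

Definition boundary_edge (B : set eis) (e : eis * eis) : Prop :=
  [/\ adj_edge e, B (left_cell e) & ~ B (right_cell e)].

Definition next_edge (B : set eis) (e : eis * eis) : eis * eis :=
  step `[< ~ B (right_cell (step true e)) >] e.

(* Three cells meet at the head of [e], and the third one decides which edge comes next. *)
Lemma boundary_edge_next B e f : boundary_edge B e -> boundary_edge B f ->
  f.1 = e.2 -> f = next_edge B e.
Proof.
move=> [he le re] [hf lf rf] fe; rewrite /next_edge; case: asboolP => C.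
  case: (adj_edge_succ he hf fe) => // fE; [case: C|case: re].
    suff -> : right_cell (step true e) = left_cell f by [].
    rewrite fE /right_cell /left_cell /step /mulomega; case: (e) => -[x y] [x' y'] /=.
    by congr (_, _) => /=; ring.
  suff -> : right_cell e = left_cell f by [].
  rewrite fE /right_cell /left_cell /mulomega; case: (e) => -[x y] [x' y'] /=.
  by congr (_, _) => /=; ring.
case: (adj_edge_succ he hf fe) => // fE; first by rewrite fE in rf.
case: re; suff -> : right_cell e = left_cell f by [].
rewrite fE /right_cell /left_cell /mulomega; case: (e) => -[x y] [x' y'] /=.
by congr (_, _) => /=; ring.
Qed.

(** Since each boundary edge has a forced successor, a boundary path is an orbit of [next_edge]. The
    second conclusion serves for the closing edge. *)
Lemma boundary_traject B p v q : {in edges p (v :: q), forall e, boundary_edge B e} ->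
  edges p (v :: q) = traject (next_edge B) (p, v) (size q).+1 /\
  (forall f, boundary_edge B f -> f.1 = last v q ->
     f = iter (size q).+1 (next_edge B) (p, v)).
Proof.
elim: q p v => [|u q IH] p v hb.
  by split=> // f hf fv; apply: boundary_edge_next => //; apply: hb; rewrite inE.
have pvE : (v, u) = next_edge B (p, v).
  by apply: boundary_edge_next => //; apply: hb; rewrite !inE eqxx ?orbT.
have [|e1 e2] := IH v u; first by move=> e he; apply: hb; rewrite inE he orbT.
split=> [|f hf fv].
  rewrite (_ : edges p _ = (p, v) :: edges v (u :: q)) // e1 pvE //.
by rewrite iterSr -pvE; apply: e2.
Qed.

(** A repetition in a closed orbit, pushed forward by [f], makes [x] itself recur too early. Thus
    only the first edge of a walk has to be checked for recurrence. *)
Lemma traject_uniq (T : eqType) (f : T -> T) x n :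
  iter n.+1 f x = x -> x \notin traject f (f x) n -> uniq (traject f x n.+1).
Proof.
move=> fx; apply: contraR; rewrite looping_uniq negbK /looping => /trajectP[i hi e].
by apply/trajectP; exists i; rewrite // -iterSr iterS -e -iterS fx.
Qed.

Lemma walk_of_steps w s : size s = size w ->
  (forall i, (i.+1 < size w)%N -> nth (0, 0) s i.+1 = step (nth false w i) (nth (0, 0) s i)) ->
  s = walk (head (0, 0) s) w.
Proof.
elim: w s => [|t w IH] [|e s] //= [sw] hs; congr (_ :: _).
case: w s sw IH hs => [|t' w] [|f s] // sw IH hs.
have /= <- := hs 0%N isT.
by rewrite [LHS]IH //= => i hi; exact: (hs i.+1).
Qed.

(** Unlike a walk, this is cyclic: it also prescribes the turn from the last edge to the first
    one. *)
Definition turns (p : eis) (q : seq eis) (w : seq bool) :=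
  forall i, edge_at p q i.+1 = step (nth false w (i %% size w)) (edge_at p q i).

Lemma turns_walk e w : (0 < size w)%N -> walk_end e w = e ->
  turns e.1 (map snd (walk e w)) w.
Proof.
move=> n0 cl i; rewrite /edge_at edges_walk size_map size_walk.
have hi : (i %% size w < size w)%N by rewrite ltn_mod.
rewrite (nth_walk _ hi) -addn1 -modnDml addn1.
have stepE : step (nth false w (i %% size w)) (walk_end e (take (i %% size w) w)) =
    walk_end e (take (i %% size w).+1 w).
  by rewrite (take_nth false) // -cats1 walk_end_cat.
rewrite stepE; case: (ltnP (i %% size w).+1 (size w)) => h.
  by rewrite modn_small // nth_walk.
have -> : (i %% size w).+1 = size w by apply/eqP; rewrite eqn_leq hi.
by rewrite modnn nth_walk // take0 take_size cl.
Qed.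

Lemma turns_weaves p q w i : edge_path p q -> turns p q w -> (0 < size w)%N ->
  size q = size w ->
  weaves p q i = (nth false w ((i + (size w).-1) %% size w) != nth false w (i %% size w)).
Proof.
move=> pq hw n0 sq; rewrite /weaves sq.
set j := (i + (size w).-1)%N.
have jE : j.+1 = (i + size w)%N by rewrite /j -addnS prednK.
have -> : edge_at p q i.+1 = edge_at p q j.+2.
  by rewrite /edge_at sq jE -addSn modnDr.
rewrite hw hw jE modnDr parallel_step2 //.
apply: (edge_path_adj pq); rewrite /edge_at mem_nth // size_edges sq.
by rewrite ltn_mod.
Qed.

Lemma turns_non_backtracking p q w : edge_path p q -> turns p q w -> (0 < size w)%N ->
  size q = size w -> non_backtracking p q.
Proof.
move=> pq hw n0 sq i hi; rewrite /parallel hw turn_step; first by case: ifP.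
by apply: (edge_path_adj pq); rewrite /edge_at mem_nth // size_edges ltn_mod sq.
Qed.

(** Even length keeps the alternation consistent across the closing step: of two cyclically
    consecutive turns exactly one is flipped. The first turn is kept, as the chirality condition
    demands. *)
Lemma alternate_shadows p q p' q' w : (0 < size w)%N -> ~~ odd (size w) ->
  lattice 0 p' -> edge_path p q -> edge_path p' q' -> size q = size w -> size q' = size w ->
  turns p q w -> turns p' q' (alternate false w) -> shadows p q p' q'.
Proof.
move=> n0 ev hp pq pq' sq sq' hw hw'.
have n0' : (0 < size (alternate false w))%N by rewrite size_alternate.
have sq'' : size q' = size (alternate false w) by rewrite size_alternate.
split; first by rewrite sq'.
- exact: turns_non_backtracking hw' _ _.
- move=> i _; rewrite /winds (turns_weaves _ pq' hw') // (turns_weaves _ pq hw) // size_alternate.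
  rewrite !nth_alternate ?ltn_mod // !addbF !odd_mod // ?(negPf ev) //.
  rewrite oddD -subn1 oddB // (negPf ev) /=.
  by case: (odd i); case: (nth _ _ _); case: (nth _ _ _).
- rewrite hw' hw !mod0n nth_alternate // !addbF !turn_step //.
    by apply: (edge_path_adj pq); rewrite /edge_at mem_nth // size_edges ltn_mod sq.
  by apply: (edge_path_adj pq'); rewrite /edge_at mem_nth // size_edges ltn_mod sq'.
Qed.

(** Chirality gives the first turn of a shadow; each later turn follows from the preceding one and
    from whether the shadow weaves between them. *)
Lemma shadow_walk p q p' q' w : (1 < size w)%N -> size q = size w ->
  edges p q = walk (head (0, 0) (edges p q)) w -> edge_path p q -> shadows p q p' q' ->
  edges p' q' = walk (head (0, 0) (edges p' q')) (alternate false w).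
Proof.
move=> n1 sq qE pq [[hp pq' sq'] nb hw ht]; rewrite sq in sq'; rewrite sq in hw.
rewrite /non_backtracking sq' in nb.
have n0 : (0 < size w)%N by exact: ltnW.
have adjE i : (i < size w)%N -> adj_edge (nth (0, 0) (edges p q) i).
  by move=> hi; apply: (edge_path_adj pq); rewrite mem_nth // size_edges sq.
have adjE' i : (i < size w)%N -> adj_edge (nth (0, 0) (edges p' q') i).
  by move=> hi; apply: (edge_path_adj pq'); rewrite mem_nth // size_edges sq'.
have stepE i : (i.+1 < size w)%N ->
    nth (0, 0) (edges p q) i.+1 = step (nth false w i) (nth (0, 0) (edges p q) i).
  move=> hi; rewrite qE !nth_walk // 1?ltnW // (take_nth false) 1?ltnW //.
  by rewrite -cats1 walk_end_cat.
have stepE' i : (i.+1 < size w)%N -> exists t,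
    nth (0, 0) (edges p' q') i.+1 = step t (nth (0, 0) (edges p' q') i).
  move=> hi; have := nb i (ltnW hi); rewrite /edge_at sq' !modn_small // 1?ltnW // => npar.
  have linked : (nth (0, 0) (edges p' q') i.+1).1 = (nth (0, 0) (edges p' q') i).2.
    by apply: edges_linked; rewrite sq'.
  case: (adj_edge_succ (adjE' _ (ltnW hi)) (adjE' _ hi) linked) => [->|->|fE].
  - by exists true.
  - by exists false.
  move: npar; rewrite fE /parallel /turn /=.
  by case: (nth _ _ _) => -[x y] [x' y'] /=; rewrite (_ : _ - _ = 0) //; ring.
apply: walk_of_steps; rewrite ?size_alternate ?size_edges //.
elim=> [|i IH] hi; have [t tE] := stepE' _ hi; rewrite tE; congr step.
  rewrite nth_alternate // !addbF.
  move: ht; rewrite /edge_at sq sq' !modn_small //.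
  rewrite tE stepE // !turn_step ?adjE ?adjE' //.
  by case: (nth _ _ _); case: t {tE}.
rewrite nth_alternate 1?ltnW // addbF.
have h1 : (i.+1 < size w)%N by exact: ltnW.
have h0 : (i < size w)%N by exact: ltnW.
have prevE : ((i.+1 + (size w).-1) %% size w = i)%N.
  by rewrite addSnnS prednK // modnDr modn_small.
move: (hw _ h1); rewrite /winds /weaves /edge_at sq sq' prevE !modn_small //.
rewrite tE IH // !stepE // !parallel_step2 ?adjE ?adjE' // nth_alternate //.
rewrite addbF /=; clear; move: (nth false w i) (nth false w i.+1) t (odd i).
by do 4!case.
Qed.

(** * From the turn word of the boundary to the invariant *)

Section BoundaryWord.

Variables (B : set eis) (e0 : eis * eis) (w : seq bool).
Hypotheses (e0_L0 : lattice 0 e0.1) (e0_adj : adj_edge e0).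
Hypotheses (w_gt0 : (0 < size w)%N) (w_even : ~~ odd (size w)).
Hypothesis w_closed : walk_end e0 w = e0.
Hypothesis w_boundary : forall e, e \in walk e0 w <-> boundary_edge B e.
Hypothesis w_once : e0 \notin behead (walk e0 w).

Lemma walk_traject : walk e0 w = traject (next_edge B) e0 (size w) /\
  iter (size w) (next_edge B) e0 = e0.
Proof.
have sE := size_walk e0 w; have wE := edges_walk e0 w; have lE := last_walk e0 w.
have e0w : e0 \in walk e0 w by move: w_gt0; case: (w) => //= t w' _; rewrite inE eqxx.
case: (map _ _) wE lE => [|v q] /= wE lE; first by move: w_gt0; rewrite -sE -wE.
have e0E : e0 = (e0.1, v).
  by move: wE w_gt0; case: (w) => //= t w' [<-].
have sq : (size q).+1 = size w by rewrite -sE -wE /= size_pairmap.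
have [|h1 h2] := @boundary_traject B e0.1 v q.
  by move=> e; rewrite (_ : edges _ _ = walk e0 w) // => /w_boundary.
have {}wE : edges e0.1 (v :: q) = walk e0 w by [].
rewrite -wE h1 -e0E sq; split=> //.
apply: esym; rewrite -sq [X in iter _ _ X]e0E; apply: h2; first exact/w_boundary.
by rewrite lE w_closed.
Qed.

Lemma walk_uniq : uniq (walk e0 w).
Proof.
have [h1 h2] := walk_traject; move: w_once; rewrite h1.
by case: (size w) h2 => [|n] // h2 h3; exact: traject_uniq.
Qed.

Lemma walk_ccw_boundary : ccw_boundary B e0.1 (map snd (walk e0 w)).
Proof.
split=> //; rewrite ?edges_walk.
- exact: edge_path_walk.
- by rewrite /is_closed last_walk w_closed.
- exact: walk_uniq.
- by move=> e; rewrite w_boundary.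
Qed.

(** The grid is bipartite: each step switches the tail between L_0 and L_1. *)
Lemma walk_end_lattice e w' : adj_edge e -> lattice 0 e.1 ->
  lattice 0 (walk_end e w').1 = ~~ odd (size w').
Proof.
move=> he h0.
suff : forall e, adj_edge e -> lattice 0 (walk_end e w').1 = lattice 0 e.1 (+) odd (size w').
  by move=> ->; rewrite // h0.
elim: w' {e he h0} => [|t w' IH] e he /=; first by rewrite addbF.
rewrite IH ?step_adj // addbN -addNb; congr addb.
case: e he => -[x y] [x' y'] /grid_adjP[q hq]; rewrite /lattice /=; clear -hq; lia.
Qed.

(** Two boundary paths have the same edges and the same successor map, so they differ by a cyclic
    shift. It is even because both start in L_0, which keeps the flipped turns in phase. *)
Lemma boundary_rotation p q : ccw_boundary B p q -> exists w1 w2,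
  [/\ w = w1 ++ w2, ~~ odd (size w1) & edges p q = walk (walk_end e0 w1) (w2 ++ w1)].
Proof.
move=> [p0 pq cl uq hq].
have memE : edges p q =i walk e0 w.
  by move=> e; apply/idP/idP => /[dup] _; [move/hq/w_boundary|move/w_boundary/hq].
have sq : size q = size w.
  rewrite -(size_edges p) -(size_walk e0).
  by apply/eqP; rewrite -(uniq_size_uniq walk_uniq) // => e; rewrite memE.
case: q => [|v q] in pq cl uq hq memE sq *; first by move: w_gt0; rewrite -sq.
have [|qE _] := @boundary_traject B p v q; first by move=> e /hq.
have : (p, v) \in walk e0 w by rewrite -memE inE eqxx.
have [wE wcl] := walk_traject; rewrite wE => /trajectP[k kn pvE].
exists (take k w), (drop k w); rewrite cat_take_drop; split=> //.
  rewrite -(@walk_end_lattice e0) //.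
  suff <- : (p, v) = walk_end e0 (take k w) by [].
  by rewrite -nth_walk // wE (set_nth_default e0) ?size_traject // nth_traject.
have sk : size (take k w) = k by rewrite size_takel // ltnW.
rewrite walk_cat -walk_end_cat cat_take_drop w_closed.
rewrite qE (_ : (size q).+1 = size w) // pvE.
have -> : traject (next_edge B) (iter k (next_edge B) e0) (size w) =
    rot k (traject (next_edge B) e0 (size w)).
  rewrite -(subnKC (ltnW kn)) [in RHS]trajectD.
  rewrite -[X in rot X]( size_traject (next_edge B) e0 k) rot_size_cat addnC trajectD.
  by rewrite -iterD subnK ?wcl // ltnW.
rewrite -wE -{1}(cat_take_drop k w) walk_cat -{1}sk -(size_walk e0) rot_size_cat.
by [].
Qed.

(** The hypothesis ranges over all starting edges because the position and direction of a shadow are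
    free. *)
Lemma invariant_of_boundary_word (R : realType) (A : int) :
  (forall e, adj_edge e -> walk_end e (alternate false w) = e /\
     \sum_(f <- walk e (alternate false w)) cross f.1 f.2 = 6 * A) ->
  Conway_Lagarias_invariant_is B (A%:~R : R).
Proof.
move=> hA.
have w_gt1 : (1 < size w)%N by move: w_gt0 w_even; case: (w) => [|? []].
split.
  pose e1 : eis * eis := ((0, 0), (1, 0)).
  have e1_adj : adj_edge e1 by [].
  exists e0.1, (map snd (walk e0 w)), e1.1, (map snd (walk e1 (alternate false w))).
  split; first exact: walk_ccw_boundary.
  apply: (alternate_shadows w_gt0 w_even); rewrite ?size_map ?size_walk ?size_alternate //.
  - exact: edge_path_walk.
  - exact: edge_path_walk.
  - exact: turns_walk.
  - by apply: turns_walk; [rewrite size_alternate|case: (hA e1 e1_adj)].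
move=> p q p' q' hB hS.
have [w1 [w2 [wE ev1 qE]]] := boundary_rotation hB.
have sw : size (w2 ++ w1) = size w by rewrite wE !size_cat addnC.
have [_ pq _ _ _] := hB; have [[_ pq' _] _ _ _] := hS.
have sq : size q = size (w2 ++ w1) by rewrite -(size_edges p) qE size_walk.
have n1 : (1 < size (w2 ++ w1))%N by rewrite sw.
have qE' : edges p q = walk (head (0, 0) (edges p q)) (w2 ++ w1).
  by rewrite {1}qE; congr walk; rewrite qE; case: (w2 ++ w1) n1.
have := shadow_walk n1 sq qE' pq hS.
set e' := head _ _ => q'E.
have e'E : e'.1 = p' /\ adj_edge e'.
  rewrite /e'; have sq' : size q' = size w by rewrite -(size_edges p') q'E size_walk size_alternate.
  case: (q') pq' sq' => [|v q''] /=; first by move=> _ h; move: w_gt0; rewrite -h.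
  by case/andP.
have [p'E e'_adj] := e'E.
(* The shadow reads the word from after [w1]. Going back along [w1] reaches an edge where the whole
   word can be read; as that walk closes, its two pieces can be exchanged. *)
have [e1 e1_adj e1E] := walk_end_surj (alternate false w1) e'_adj.
have [cl area] := hA e1 e1_adj.
have ev2 : ~~ odd (size w2) by move: w_even; rewrite wE size_cat oddD (negPf ev1).
rewrite wE alternate_cat /= (negPf ev1) walk_end_cat e1E in cl.
rewrite wE alternate_cat /= (negPf ev1) walk_cat e1E in area.
rewrite alternate_cat /= (negPf ev2) walk_cat cl in q'E.
have cl' : is_closed p' q'.
  rewrite /is_closed -{1}(map_snd_edges p' q') q'E -p'E -{1}cl -walk_cat last_walk.
  by rewrite walk_end_cat cl e1E.
split=> //; apply: signed_areaE => //.
by rewrite q'E big_cat /= addrC -big_cat.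
Qed.

End BoundaryWord.

(** * Benzels as intersections of half-planes *)

Section Hull.
Variable R : realType.
Implicit Types (X Y : R) (s : seq eis).

Definition omega_point X Y : R[i] := Complex (X - Y / 2) (Num.sqrt 3 / 2 * Y).

Lemma omega_pointP (z : R[i]) : exists X Y, z = omega_point X Y.
Proof.
have s3 : Num.sqrt 3 != 0 :> R by rewrite gt_eqF // sqrtr_gt0.
case: z => x y; exists (x + y / Num.sqrt 3), (2 * y / Num.sqrt 3).
by congr Complex; field.
Qed.

Lemma omega_point_inj X Y X' Y' :
  omega_point X Y = omega_point X' Y' -> X = X' /\ Y = Y'.
Proof.
have s3 : Num.sqrt 3 / 2 != 0 :> R by rewrite gt_eqF // divr_gt0 // sqrtr_gt0.
by case=> e1 /(mulfI s3) e2; rewrite e2 in e1 *; split=> //; move: e1; lra.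
Qed.

Lemma omega2 : omega R ^+ 2 = - 1 - omega R.
Proof.
rewrite /omega expr2; apply/eqP; rewrite eq_complex /=; apply/andP; split; apply/eqP.
  have : Num.sqrt 3 * Num.sqrt 3 = 3 :> R by rewrite -expr2 sqr_sqrtr.
  by lra.
by lra.
Qed.

Lemma hullP s X Y : hull [seq toC R v | v <- s] (omega_point X Y) <->
  exists t : nat -> R, [/\ forall i, 0 <= t i, \sum_(i < size s) t i = 1,
    X = \sum_(i < size s) t i * (nth 0 s i).1%:~R &
    Y = \sum_(i < size s) t i * (nth 0 s i).2%:~R].
Proof.
have sumE (t : nat -> R) :
    \sum_(i < size [seq toC R v | v <- s]) (t i)%:C%C * [seq toC R v | v <- s]`_i =
    omega_point (\sum_(i < size s) t i * (nth 0 s i).1%:~R)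
                (\sum_(i < size s) t i * (nth 0 s i).2%:~R).
  rewrite size_map.
  under eq_bigr => i _ do rewrite (nth_map 0) // toCE.
  rewrite /omega_point mulr_suml -sumrB mulr_sumr; apply/eqP; rewrite eq_complex.
  rewrite !raddf_sum /=; apply/andP; split; apply/eqP; apply: eq_bigr => i _ /=; ring.
split=> -[t].
  move=> [t0 t1]; rewrite sumE => /omega_point_inj[-> ->]; exists t.
  by rewrite size_map in t1.
by move=> [t0 t1 -> ->]; exists t; rewrite sumE size_map.
Qed.

Lemma hull_le s X Y (p q c : int) : hull [seq toC R v | v <- s] (omega_point X Y) ->
  all (fun v : eis => p * v.1 + q * v.2 <= c) s -> p%:~R * X + q%:~R * Y <= c%:~R.
Proof.
move=> /hullP[t [t0 t1 -> ->]] /all_nthP h.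
have -> : c%:~R = \sum_(i < size s) t i * c%:~R by rewrite -mulr_suml t1 mul1r.
rewrite !mulr_sumr -big_split /=.
apply: ler_sum => i _; have := h 0 i (ltn_ord i); rewrite -(ler_int R) rmorphD !rmorphM /= => hi.
by apply: (le_trans _ (ler_wpM2l (t0 i) hi)); rewrite le_eqVlt; apply/orP; left; apply/eqP; ring.
Qed.

Lemma cellE (al : eis) : cell R al = hull [seq toC R v |
  v <- [:: al + (1, 0); al - (1, 0); al + (0, 1); al - (0, 1); al - (1, 1); al + (1, 1)]].
Proof.
rewrite /cell /= omega2; congr (hull [:: _; _; _; _; _; _]);
  rewrite /toC /= ?rmorphD ?rmorphN /=; ring.
Qed.

Lemma hexagonE (a b : int) : benzel_hexagon R a b = hull [seq toC R v |
  v <- [:: (b, a); (a - b, a); (- a, b - a); (- a, - b); (a - b, - b); (b, b - a)]].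
Proof.
rewrite /benzel_hexagon /= omega2; congr (hull [:: _; _; _; _; _; _]);
  rewrite /toC /= ?rmorphB ?rmorphN /=; ring.
Qed.

Definition in_hexagon (a b : int) (v : eis) : bool :=
  [&& - a <= v.1 <= b, - b <= v.2 <= a & - a <= v.2 - v.1 <= b].

Lemma hull_bounds s X Y (a b : int) : hull [seq toC R v | v <- s] (omega_point X Y) ->
  all (in_hexagon a b) s ->
  [/\ - a%:~R <= X <= b%:~R, - b%:~R <= Y <= a%:~R & - a%:~R <= Y - X <= b%:~R].
Proof.
move=> h /allP hs.
have bound (p q c : int) : (forall v, in_hexagon a b v -> p * v.1 + q * v.2 <= c) ->
    p%:~R * X + q%:~R * Y <= c%:~R.
  by move=> hc; apply: (hull_le h); apply/allP => v /hs /hc.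
have h1 := bound 1 0 b; have h2 := bound (-1) 0 a; have h3 := bound 0 1 a.
have h4 := bound 0 (-1) b; have h5 := bound (-1) 1 b; have h6 := bound 1 (-1) a.
have {}h1 : X <= b%:~R by apply: le_trans (h1 _) => [|v]; rewrite /in_hexagon; [lra|lia].
have {}h2 : - X <= a%:~R by apply: le_trans (h2 _) => [|v]; rewrite /in_hexagon; [lra|lia].
have {}h3 : Y <= a%:~R by apply: le_trans (h3 _) => [|v]; rewrite /in_hexagon; [lra|lia].
have {}h4 : - Y <= b%:~R by apply: le_trans (h4 _) => [|v]; rewrite /in_hexagon; [lra|lia].
have {}h5 : Y - X <= b%:~R by apply: le_trans (h5 _) => [|v]; rewrite /in_hexagon; [lra|lia].
have {}h6 : X - Y <= a%:~R by apply: le_trans (h6 _) => [|v]; rewrite /in_hexagon; [lra|lia].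
by split; apply/andP; split; lra.
Qed.

Lemma hexagonP (a b : int) X Y : 0 < a -> 0 < b -> a <= 2 * b -> b <= 2 * a ->
  (benzel_hexagon R a b (omega_point X Y) <->
   [/\ - a%:~R <= X <= b%:~R, - b%:~R <= Y <= a%:~R & - a%:~R <= Y - X <= b%:~R]).
Proof.
move=> a0 b0 ab ba; rewrite hexagonE; split=> [h|].
  by apply: hull_bounds h _; rewrite /in_hexagon /=; clear -a0 b0 ab ba; lia.
case=> /andP[X1 X2] /andP[Y1 Y2] /andP[D1 D2]; apply/hullP.
pose mk (s : seq R) (i : nat) := nth 0 s i.
have mk_ge0 (s : seq R) : all (fun x => 0 <= x) s -> forall i, 0 <= mk s i.
  move=> /allP s0 i; rewrite /mk; case: (ltnP i (size s)) => h; last by rewrite nth_default.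
  by apply: s0; exact: mem_nth.
have ab' : a%:~R <= 2 * b%:~R :> R by rewrite -(ler_int R) rmorphM in ab.
have ba' : b%:~R <= 2 * a%:~R :> R by rewrite -(ler_int R) rmorphM in ba.
(* The horizontal diagonal at height b - a cuts the hexagon into two trapezoids. *)
have frac (u v : R) : 0 <= u <= v -> exists2 l, 0 <= l <= 1 & l * v = u.
  move=> /andP[u0 uv]; case: (eqVneq v 0) => [v0|vn0].
    (* This degenerate case occurs: for b = 2a the upper trapezoid has height 0. *)
    by exists 0; rewrite ?lexx ?ler01 // mul0r; apply/eqP; rewrite eq_le u0 -v0 uv.
  have v0 : 0 < v by rewrite lt_neqAle eq_sym vn0 (le_trans u0).
  by exists (u / v); rewrite ?divfK // divr_ge0 ?ler_pdivrMr ?mul1r ?(le_trans u0 uv).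
case: (leP (b%:~R - a%:~R) Y) => hY.
  have [|l /andP[l0 l1] lE] := frac (Y - (b%:~R - a%:~R)) (2 * a%:~R - b%:~R).
    by apply/andP; split; lra.
  have [|m /andP[m0 m1] mE] := frac (X - Y + b%:~R) (2 * b%:~R - Y).
    by apply/andP; split; lra.
  (* The weights interpolate by [l] in height between the parallel sides and by [m] from left to
     right at that height. *)
  exists (mk [:: l * m; l * (1 - m); (1 - l) * (1 - m); 0; 0; (1 - l) * m]).
  rewrite !big_ord_recr !big_ord0 /mk /= !rmorphB !rmorphN /=; split.
  - by apply: mk_ge0; rewrite /= !mulr_ge0 ?subr_ge0 ?lexx.
  - by ring.
  - transitivity ((1 - m) * (- a%:~R + l * (2 * a%:~R - b%:~R)) + m * b%:~R); last by ring.
    by rewrite lE; move: mE; lra.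
  - by transitivity (b%:~R - a%:~R + l * (2 * a%:~R - b%:~R)); [rewrite lE|]; ring.
have [|l /andP[l0 l1] lE] := frac (Y + b%:~R) (2 * b%:~R - a%:~R).
  by apply/andP; split; lra.
have [|m /andP[m0 m1] mE] := frac (X + a%:~R) (Y + 2 * a%:~R).
  by apply/andP; split; lra.
exists (mk [:: 0; 0; l * (1 - m); (1 - l) * (1 - m); (1 - l) * m; l * m]).
rewrite !big_ord_recr !big_ord0 /mk /= !rmorphB !rmorphN /=; split.
- by apply: mk_ge0; rewrite /= !mulr_ge0 ?subr_ge0 ?lexx.
- by ring.
- transitivity ((1 - m) * (- a%:~R) + m * (a%:~R - b%:~R + l * (2 * b%:~R - a%:~R))).
    by rewrite lE; move: mE; lra.
  by ring.
- by transitivity (- b%:~R + l * (2 * b%:~R - a%:~R)); [rewrite lE|]; ring.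
Qed.

(** From the center of a cell to its corners, each of x, y and y - x varies by -1, 0 or 1 and
    attains both extremes; over the integers the large inequalities at the corners are thus the
    strict ones at the center. *)
Lemma benzelE (a b x y : int) : 0 < a -> 0 < b -> a <= 2 * b -> b <= 2 * a ->
  (benzel R a b (x, y) <->
   [/\ lattice (-1) (x, y), - a < x < b, - b < y < a & - a < y - x < b]).
Proof.
move=> a0 b0 ab ba; rewrite /benzel /= cellE.
split=> [[hl sub]|[hl hx hy hd]].
  set s := [:: _; _; _; _; _; _] in sub.
  have corner_in v : v \in s ->
      [/\ - a <= v.1 <= b, - b <= v.2 <= a & - a <= v.2 - v.1 <= b].
    move=> hv; have : benzel_hexagon R a b (omega_point v.1%:~R v.2%:~R).
      apply: sub; apply/hullP; exists (fun i => (i == index v s)%:R).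
      have hi : (index v s < size s)%N by rewrite index_mem.
      have sumE (f : nat -> R) :
          \sum_(i < size s) (i == index v s :> nat)%:R * f i = f (index v s).
        rewrite (bigD1 (Ordinal hi)) //= eqxx mul1r big1 ?addr0 // => i.
        by rewrite -val_eqE /= => /negPf ->; rewrite mul0r.
      split=> [i|||]; first by rewrite ler0n.
      - by rewrite -[RHS](sumE (fun=> 1)); apply: eq_bigr => i _; rewrite mulr1.
      - by rewrite (sumE (fun i => (nth 0 s i).1%:~R)) nth_index.
      - by rewrite (sumE (fun i => (nth 0 s i).2%:~R)) nth_index.
    move=> /hexagonP => /(_ a0 b0 ab ba); rewrite -!rmorphN -!rmorphD /= !ler_int.
    by case.
  have : all (in_hexagon a b) s.
    by apply/allP => v /corner_in[]; rewrite /in_hexagon => -> -> ->.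
  by rewrite /s /in_hexagon /= => h; split=> //; clear -h; lia.
split=> // z; have [X [Y ->]] := omega_pointP z => h; apply/hexagonP => //.
by apply: hull_bounds h _; rewrite /in_hexagon /=; clear -hx hy hd; lia.
Qed.

End Hull.

(** * Motions of turn words *)

Definition omega_mul (u v : eis) : eis :=
  (u.1 * v.1 - u.2 * v.2, u.1 * v.2 + u.2 * v.1 - u.2 * v.2).

(* In the coordinates where the initial direction is 1, a word moves the walker by [sigma],
   turns it by the factor [zeta], and sweeps the doubled area [kappa]. *)
Fixpoint motion (w : seq bool) : eis * eis * int :=
  if w is t :: w' then
    let: (sigma, zeta, kappa) := motion w' in
    let r := if t then (1, 1) else (0, -1) in
    ((1, 0) + omega_mul r sigma, omega_mul r zeta, kappa + (omega_mul r sigma).2)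
  else (0, (1, 0), 0).

Definition walk_area e w := \sum_(f <- walk e w) cross f.1 f.2.

(** Multiplication by [d] scales determinants by [sqnorm d], and translation by [v] adds the
    determinant of [v] with the total displacement. *)
Lemma motionP w (v d : eis) : let: (sigma, zeta, kappa) := motion w in
  walk_end (v, v + d) w =
    (v + omega_mul sigma d, v + omega_mul sigma d + omega_mul zeta d) /\
  walk_area (v, v + d) w = cross v (omega_mul sigma d) + kappa * sqnorm d.
Proof.
elim: w v d => [|t w IH] v d /=.
  rewrite /walk_area big_nil /omega_mul /cross; split; last by rewrite /=; ring.
  case: v d => [x y] [p q] /=; congr (_, _); congr (_, _) => /=; ring.
have := IH (v + d) (omega_mul (if t then (1, 1) else (0, -1)) d).
case: (motion w) => [[sigma zeta] kappa].
have -> : (v + d, v + d + omega_mul (if t then (1, 1) else (0, -1)) d) = step t (v, v + d).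
  case: v d => [x y] [p q]; rewrite /step /mulomega /omega_mul; case: t;
    congr (_, (_, _)) => /=; ring.
move=> [-> areaE]; split.
  case: v d sigma zeta {areaE} => [x y] [p q] [s1 s2] [z1 z2]; rewrite /omega_mul; case: t;
    congr ((_, _), (_, _)) => /=; ring.
rewrite /walk_area /= big_cons [X in _ + X]areaE /cross /sqnorm.
case: v d sigma {areaE zeta} => [x y] [p q] [s1 s2]; rewrite /omega_mul; case: t => /=; ring.
Qed.

(** The product of a semidirect product of rotations and translations, extended by the area cocycle
    [cross]. *)
Definition compose_motion (g h : eis * eis * int) : eis * eis * int :=
  let: (sigma, zeta, kappa) := g in let: (sigma', zeta', kappa') := h in
  (sigma + omega_mul zeta sigma', omega_mul zeta zeta',
   kappa + kappa' * sqnorm zeta + cross sigma (omega_mul zeta sigma')).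

Lemma motion_cat w1 w2 : motion (w1 ++ w2) = compose_motion (motion w1) (motion w2).
Proof.
elim: w1 => [|t w IH] /=.
  case: (motion w2) => [[[s1 s2] [z1 z2]] k]; rewrite /omega_mul /cross /sqnorm /=.
  by congr ((_, _), (_, _), _) => /=; ring.
rewrite IH; case: (motion w) => [[[s1 s2] [z1 z2]] k].
case: (motion w2) => [[[s1' s2'] [z1' z2']] k'] /=; rewrite /omega_mul /cross /sqnorm /=.
by case: t; congr ((_, _), (_, _), _) => /=; ring.
Qed.

(** Consecutive cells of L_{-1} along a side of the hexagon are at distance 3; this is the outline
    from one of them to the next. *)
Definition arm := [:: false; false; true; true].

Definition arms (n : nat) : seq bool := flatten (nseq n arm).

Lemma size_arms n : size (arms n) = (4 * n)%N.
Proof. by rewrite size_flatten /shape map_nseq sumn_nseq. Qed.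

Lemma alternate_arms b n : alternate b (arms n) = flatten (nseq n (alternate b arm)).
Proof.
by elim: n => [|n IH] //; rewrite -[arms n.+1]/(arm ++ arms n) alternate_cat addbF IH.
Qed.

(** A flipped period still runs straight, now along its initial direction; the phase only decides
    the sign of the area. Periods have even length, so all of them are in the same phase. *)
Lemma motion_alternate_arms b n :
  motion (alternate b (arms n)) = ((3 * n%:Z, 0), (1, 0), (if b then -3 else 3) * n%:Z).
Proof.
rewrite alternate_arms; elim: n => [|n IH]; first by rewrite /= !mulr0.
have armE : motion (alternate b arm) = ((3, 0), (1, 0), if b then -3 else 3) by case: b {IH}.
rewrite -[flatten _]/(alternate b arm ++ flatten (nseq n (alternate b arm))) motion_cat IH armE.
rewrite intS /compose_motion /omega_mul /cross /sqnorm.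
by congr ((_, _), (_, _), _) => /=; ring.
Qed.

(** * Rotation by omega, and the edges of the arms *)

Definition rotate (e : eis * eis) : eis * eis := (mulomega e.1, mulomega e.2).

Lemma rotate3 e : rotate (rotate (rotate e)) = e.
Proof.
by case: e => -[x y] [x' y']; rewrite /rotate /mulomega; congr ((_, _), (_, _)) => /=; ring.
Qed.

Lemma walk_rotate e w : walk (rotate e) w = map rotate (walk e w).
Proof.
elim: w e => //= t w IH e; rewrite -IH; congr (_ :: walk _ _).
by case: e => -[x y] [x' y']; rewrite /step /rotate /mulomega; case: t;
  congr ((_, _), (_, _)) => /=; ring.
Qed.

Lemma walk_end_rotate e w : walk_end (rotate e) w = rotate (walk_end e w).
Proof.
elim: w e => //= t w IH e; rewrite -IH; congr walk_end.
by case: e => -[x y] [x' y']; rewrite /step /rotate /mulomega; case: t;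
  congr ((_, _), (_, _)) => /=; ring.
Qed.

(** The tails of period j have abscissas X - 3j, X - 3j - 1 and X - 3j - 2 only, so the abscissa of
    the tail determines the period. *)
Lemma mem_arms_left (m : nat) (X Y x y x' y' : int) (j := ((X - x) %/ 3)%Z) :
  (((x, y), (x', y')) \in walk ((X, Y), (X - 1, Y - 1)) (arms m)) =
  (0 <= j < m%:Z) &&
    [|| [&& x == X - 3 * j, y == Y, x' == X - 3 * j - 1 & y' == Y - 1],
        [&& x == X - 3 * j - 1, y == Y - 1, x' == X - 3 * j - 2 & y' == Y - 1],
        [&& x == X - 3 * j - 2, y == Y - 1, x' == X - 3 * j - 2 & y' == Y]
      | [&& x == X - 3 * j - 2, y == Y, x' == X - 3 * j - 3 & y' == Y]].
Proof.
rewrite {}/j; elim: m X => [|m IH] X; first by rewrite in_nil; lia.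
rewrite /arms /= -/(arms m).
set e1 := step false _; have e1E : e1 = ((X - 1, Y - 1), (X - 2, Y - 1)).
  by rewrite /e1 /step /mulomega; congr ((_, _), (_, _)) => /=; ring.
set e2 := step false _; have e2E : e2 = ((X - 2, Y - 1), (X - 2, Y)).
  by rewrite /e2 e1E /step /mulomega; congr ((_, _), (_, _)) => /=; ring.
set e3 := step true _; have e3E : e3 = ((X - 2, Y), (X - 3, Y)).
  by rewrite /e3 e2E /step /mulomega; congr ((_, _), (_, _)) => /=; ring.
set e4 := step true _; have e4E : e4 = ((X - 3, Y), (X - 3 - 1, Y - 1)).
  by rewrite /e4 e3E /step /mulomega; congr ((_, _), (_, _)) => /=; ring.
rewrite e4E !inE IH e1E e2E e3E !xpair_eqE {IH e1 e1E e2 e2E e3 e3E e4 e4E} /= -!andbA.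
have -> : ((X - 3 - x) %/ 3)%Z = ((X - x) %/ 3)%Z - 1 by clear; lia.
have : 3 * ((X - x) %/ 3)%Z <= X - x < 3 * ((X - x) %/ 3)%Z + 3 by clear; lia.
move: ((X - x) %/ 3)%Z => q hq.
have -> : X - 3 - 3 * (q - 1) = X - 3 * q by ring.
have -> : [&& x == X, y == Y, x' == X - 1 & y' == Y - 1] =
    (q == 0) && [&& x == X - 3 * q, y == Y, x' == X - 3 * q - 1 & y' == Y - 1]
  by clear -hq; lia.
have -> : [&& x == X - 1, y == Y - 1, x' == X - 2 & y' == Y - 1] =
    (q == 0) && [&& x == X - 3 * q - 1, y == Y - 1, x' == X - 3 * q - 2 & y' == Y - 1]
  by clear -hq; lia.
have -> : [&& x == X - 2, y == Y - 1, x' == X - 2 & y' == Y] =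
    (q == 0) && [&& x == X - 3 * q - 2, y == Y - 1, x' == X - 3 * q - 2 & y' == Y]
  by clear -hq; lia.
have -> : [&& x == X - 2, y == Y, x' == X - 3 & y' == Y] =
    (q == 0) && [&& x == X - 3 * q - 2, y == Y, x' == X - 3 * q - 3 & y' == Y]
  by clear -hq; lia.
clear hq; move:
  ([&& x == X - 3 * q, y == Y, x' == X - 3 * q - 1 & y' == Y - 1])
  ([&& x == X - 3 * q - 1, y == Y - 1, x' == X - 3 * q - 2 & y' == Y - 1])
  ([&& x == X - 3 * q - 2, y == Y - 1, x' == X - 3 * q - 2 & y' == Y])
  ([&& x == X - 3 * q - 2, y == Y, x' == X - 3 * q - 3 & y' == Y])
  => o1 o2 o3 o4.
by case: o1; case: o2; case: o3; case: o4 => /=; lia.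
Qed.

Lemma mem_arms_down (m : nat) (X Y x y x' y' : int) (j := ((X - x) %/ 3)%Z) :
  (((x, y), (x', y')) \in walk ((X, Y), (X, Y - 1)) (arms m)) =
  (0 <= j < m%:Z) &&
    [|| [&& x == X - 3 * j, y == Y - 3 * j, x' == X - 3 * j & y' == Y - 3 * j - 1],
        [&& x == X - 3 * j, y == Y - 3 * j - 1, x' == X - 3 * j - 1 & y' == Y - 3 * j - 2],
        [&& x == X - 3 * j - 1, y == Y - 3 * j - 2, x' == X - 3 * j - 2 & y' == Y - 3 * j - 2]
      | [&& x == X - 3 * j - 2, y == Y - 3 * j - 2, x' == X - 3 * j - 3 & y' == Y - 3 * j - 3]].
Proof.
rewrite {}/j; elim: m X Y => [|m IH] X Y; first by rewrite in_nil; lia.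
rewrite /arms /= -/(arms m).
set e1 := step false _; have e1E : e1 = ((X, Y - 1), (X - 1, Y - 2)).
  by rewrite /e1 /step /mulomega; congr ((_, _), (_, _)) => /=; ring.
set e2 := step false _; have e2E : e2 = ((X - 1, Y - 2), (X - 2, Y - 2)).
  by rewrite /e2 e1E /step /mulomega; congr ((_, _), (_, _)) => /=; ring.
set e3 := step true _; have e3E : e3 = ((X - 2, Y - 2), (X - 3, Y - 3)).
  by rewrite /e3 e2E /step /mulomega; congr ((_, _), (_, _)) => /=; ring.
set e4 := step true _; have e4E : e4 = ((X - 3, Y - 3), (X - 3, Y - 3 - 1)).
  by rewrite /e4 e3E /step /mulomega; congr ((_, _), (_, _)) => /=; ring.
rewrite e4E !inE IH e1E e2E e3E !xpair_eqE {IH e1 e1E e2 e2E e3 e3E e4 e4E} /= -!andbA.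
have -> : ((X - 3 - x) %/ 3)%Z = ((X - x) %/ 3)%Z - 1 by clear; lia.
have : 3 * ((X - x) %/ 3)%Z <= X - x < 3 * ((X - x) %/ 3)%Z + 3 by clear; lia.
move: ((X - x) %/ 3)%Z => q hq.
have -> : X - 3 - 3 * (q - 1) = X - 3 * q by ring.
have -> : Y - 3 - 3 * (q - 1) = Y - 3 * q by ring.
have -> : [&& x == X, y == Y, x' == X & y' == Y - 1] =
    (q == 0) && [&& x == X - 3 * q, y == Y - 3 * q, x' == X - 3 * q & y' == Y - 3 * q - 1]
  by clear -hq; lia.
have -> : [&& x == X, y == Y - 1, x' == X - 1 & y' == Y - 2] =
    (q == 0) && [&& x == X - 3 * q, y == Y - 3 * q - 1, x' == X - 3 * q - 1 & y' == Y - 3 * q - 2]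
  by clear -hq; lia.
have -> : [&& x == X - 1, y == Y - 2, x' == X - 2 & y' == Y - 2] =
    (q == 0) && [&& x == X - 3 * q - 1, y == Y - 3 * q - 2, x' == X - 3 * q - 2 & y' == Y - 3 * q - 2]
  by clear -hq; lia.
have -> : [&& x == X - 2, y == Y - 2, x' == X - 3 & y' == Y - 3] =
    (q == 0) && [&& x == X - 3 * q - 2, y == Y - 3 * q - 2, x' == X - 3 * q - 3 & y' == Y - 3 * q - 3]
  by clear -hq; lia.
clear hq; move:
  ([&& x == X - 3 * q, y == Y - 3 * q, x' == X - 3 * q & y' == Y - 3 * q - 1])
  ([&& x == X - 3 * q, y == Y - 3 * q - 1, x' == X - 3 * q - 1 & y' == Y - 3 * q - 2])
  ([&& x == X - 3 * q - 1, y == Y - 3 * q - 2, x' == X - 3 * q - 2 & y' == Y - 3 * q - 2])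
  ([&& x == X - 3 * q - 2, y == Y - 3 * q - 2, x' == X - 3 * q - 3 & y' == Y - 3 * q - 3])
  => o1 o2 o3 o4.
by case: o1; case: o2; case: o3; case: o4 => /=; lia.
Qed.

(** * Walks with a threefold symmetry *)

Lemma rotate_boundary_edge (B : set eis) : (forall al, B (mulomega al) <-> B al) ->
  forall e, boundary_edge B (rotate e) <-> boundary_edge B e.
Proof.
move=> hB e; have lE : left_cell (rotate e) = mulomega (left_cell e).
  by case: (e) => -[x y] [x' y']; rewrite /left_cell /rotate /mulomega; congr (_, _) => /=; ring.
have rE : right_cell (rotate e) = mulomega (right_cell e).
  by case: (e) => -[x y] [x' y']; rewrite /right_cell /rotate /mulomega; congr (_, _) => /=; ring.
have aE e' : adj_edge e' -> adj_edge (rotate e').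
  case: e' => -[x y] [x' y'] /grid_adjP[q hq]; apply/grid_adjP => /=.
  by exists (q - y); lia.
have aE' : adj_edge (rotate e) = adj_edge e.
  by apply/idP/idP => [/aE/aE|/aE //]; rewrite rotate3.
by rewrite /boundary_edge aE' lE rE; split=> -[h1 /hB h2 h3]; split=> // /hB /h3.
Qed.

(** The factor (-1, -1) is omega^2, so the shadow closes since 1 + omega^2 + omega^4 = 0. Joining
    its thirds adds cross(sigma, omega^2 sigma) = - |sigma|^2, then cross(- omega sigma, omega
    sigma) = 0. *)
Lemma invariant_of_third (R : realType) (B : set eis) (e0 : eis * eis) (w : seq bool)
    (A kappa : int) (sigma : eis) :
  lattice 0 e0.1 -> adj_edge e0 -> (0 < size w)%N -> ~~ odd (size w) ->
  walk_end e0 w = rotate e0 ->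
  (forall al, B (mulomega al) <-> B al) ->
  (forall e, e \in walk e0 w -> boundary_edge B e) ->
  (forall e, boundary_edge B e ->
     [|| e \in walk e0 w, rotate e \in walk e0 w | rotate (rotate e) \in walk e0 w]) ->
  e0 \notin behead (walk e0 w) -> rotate e0 \notin walk e0 w ->
  rotate (rotate e0) \notin walk e0 w ->
  motion (alternate false w) = (sigma, (-1, -1), kappa) ->
  3 * kappa - sqnorm sigma = 6 * A ->
  Conway_Lagarias_invariant_is B (A%:~R : R).
Proof.
move=> e0_L0 e0_adj w0 ev wE hB sound complete once1 once2 once3 motE areaE.
have wE2 : walk_end (rotate e0) w = rotate (rotate e0) by rewrite walk_end_rotate wE.
have walkE : walk e0 (w ++ w ++ w) = walk e0 w ++ map rotate (walk e0 w)
    ++ map rotate (map rotate (walk e0 w)).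
  by rewrite !walk_cat wE wE2 !walk_rotate.
have rotI : injective rotate by apply: (can_inj (g := fun e => rotate (rotate e))); exact: rotate3.
have rotB := rotate_boundary_edge hB.
apply: (@invariant_of_boundary_word B e0 (w ++ w ++ w)) => //.
- by rewrite !size_cat ltn_addr.
- by rewrite !size_cat !oddD (negPf ev).
- by rewrite !walk_end_cat wE wE2 walk_end_rotate wE2 rotate3.
- move=> e; rewrite walkE !mem_cat; split.
    case/or3P => [/sound //|/mapP[f /sound hf ->]|/mapP[g /mapP[f /sound hf ->] ->]].
      exact/rotB.
    by apply/rotB/rotB.
  case/complete/or3P => [->//|h|h]; apply/or3P; [constructor 3|constructor 2].
    by rewrite -[e]rotate3 !mem_map.
  by rewrite -[e]rotate3 mem_map.
- have -> : behead (walk e0 (w ++ w ++ w)) = behead (walk e0 w) ++ map rotate (walk e0 w)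
      ++ map rotate (map rotate (walk e0 w)).
    by rewrite walkE; case: (w) w0.
  rewrite !mem_cat !negb_or once1 /=; apply/andP; split; apply/mapP => -[f hf fE].
    by move: hf once3; rewrite -{1}[f]rotate3 -fE => ->.
  case/mapP: hf => g hg gE; move: hg once2.
  by rewrite -{1}[g]rotate3 -gE -fE => ->.
move=> [v v'] vv'.
have ev2 := negPf ev.
rewrite !alternate_cat ev2 /=; have := motionP (alternate false w ++ alternate false w ++
  alternate false w) v (v' - v).
rewrite !motion_cat motE /compose_motion addrC subrK => -[-> areaE']; split.
  case: v v' sigma {vv' motE areaE areaE'} => [x y] [x' y'] [s1 s2].
  by rewrite /omega_mul; congr ((_, _), (_, _)) => /=; ring.
rewrite -/(walk_area _ _) areaE' -areaE.
have sq1 : sqnorm (v' - v) = 1 by case/and3P: vv' => _ _ /eqP.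
rewrite sq1 mulr1; case: v v' sigma {vv' motE areaE areaE' sq1} => [x y] [x' y'] [s1 s2].
by rewrite /cross /omega_mul /sqnorm /=; ring.
Qed.

Definition in_benzel (a b : int) (al : eis) : bool :=
  [&& lattice (-1) al, - a < al.1 < b, - b < al.2 < a & - a < al.2 - al.1 < b].

Lemma in_benzel_mulomega a b al : in_benzel a b (mulomega al) = in_benzel a b al.
Proof.
by case: al => x y; rewrite /in_benzel /mulomega /lattice /=; clear; apply/idP/idP; lia.
Qed.

Lemma motion_arms n : motion (arms n) = ((0, -3 * n%:Z), (1, 0), -3 * n%:Z).
Proof.
elim: n => [|n IH]; first by rewrite /= !mulr0.
have armE : motion arm = ((0, -3), (1, 0), -3) by [].
rewrite -[arms n.+1]/(arm ++ arms n) motion_cat IH armE intS /compose_motion.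
by rewrite /omega_mul /cross /sqnorm; congr ((_, _), (_, _), _) => /=; ring.
Qed.

Lemma walk_end_arms_left n X Y :
  walk_end ((X, Y), (X - 1, Y - 1)) (arms n) =
  ((X - 3 * n%:Z, Y), (X - 3 * n%:Z - 1, Y - 1)).
Proof.
have := motionP (arms n) (X, Y) (-1, -1); rewrite motion_arms => -[+ _].
by rewrite /omega_mul => ->; congr ((_, _), (_, _)) => /=; ring.
Qed.

Lemma walk_end_arms_down n X Y :
  walk_end ((X, Y), (X, Y - 1)) (arms n) =
  ((X - 3 * n%:Z, Y - 3 * n%:Z), (X - 3 * n%:Z, Y - 3 * n%:Z - 1)).
Proof.
have := motionP (arms n) (X, Y) (0, -1); rewrite motion_arms => -[+ _].
rewrite /omega_mul (_ : (X, Y) + (0, -1) = (X, Y - 1)); last by congr (_, _); rewrite /= addr0.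
by move=> ->; congr ((_, _), (_, _)) => /=; ring.
Qed.

(** * Walks around benzels *)

Definition translate (v : eis) (e : eis * eis) : eis * eis := (v + e.1, v + e.2).

Lemma translate_inj v : injective (translate v).
Proof.
move=> [g1 g2] [h1 h2] gh.
by congr (_, _); apply: (addrI v); [exact: (congr1 fst gh)|exact: (congr1 snd gh)].
Qed.

Lemma walk_translate v e w : walk (translate v e) w = map (translate v) (walk e w).
Proof.
elim: w e => //= t w IH e; rewrite -IH; congr (_ :: walk _ _).
by case: (v) (e) => [a b] [[x y] [x' y']]; rewrite /step /translate /mulomega; case: t;
  congr ((_, _), (_, _)) => /=; ring.
Qed.

Lemma translate_left X Y :
  ((X, Y), (X - 1, Y - 1)) = translate (X, Y) ((0, 0), (-1, -1)) :> eis * eis.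
Proof. by congr ((_, _), _); rewrite /= addr0. Qed.

Lemma translate_down X Y :
  ((X, Y), (X, Y - 1)) = translate (X, Y) ((0, 0), (0, -1)) :> eis * eis.
Proof. by congr ((_, _), (_, _)); rewrite /= addr0. Qed.

(** Moves the corner walks to the origin, where they are evaluated by computation. *)
Lemma mem_walk_translate (X Y x y x' y' : int) e w :
  (((x, y), (x', y')) \in walk (translate (X, Y) e) w) =
  (((x - X, y - Y), (x' - X, y' - Y)) \in walk e w).
Proof.
rewrite walk_translate -[RHS](mem_map (@translate_inj (X, Y))).
by congr (in_mem _ _); congr ((_, _), (_, _)); rewrite /= addrC subrK.
Qed.

(* The corner word [u] leads from the direction - 1 - omega to the direction - omega, and [v] from
   there to 1, the image of - 1 - omega by the rotation. *)
Section Third.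
Variables (m n : nat) (u v : seq bool) (K L : int).
(** The corner displacement (K, L), divided by the initial direction omega^2, is omega (K, L) = (-
    L, K - L); the area is left free. *)
Hypothesis uE : motion u = ((- L, K - L), (1, 1), (motion u).2).

Lemma walk_end_corner X Y :
  walk_end ((X, Y), (X - 1, Y - 1)) u = ((X + K, Y + L), (X + K, Y + L - 1)).
Proof.
have := motionP u (X, Y) (-1, -1); rewrite uE => -[+ _].
by rewrite /omega_mul => ->; congr ((_, _), (_, _)) => /=; ring.
Qed.

Lemma walk_end_closing K' L' X Y : motion v = ((K' - L', K'), (1, 1), (motion v).2) ->
  walk_end ((X, Y), (X, Y - 1)) v = ((X + K', Y + L'), (X + K' + 1, Y + L')).
Proof.
move=> vE; have := motionP v (X, Y) (0, -1); rewrite vE => -[+ _].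
rewrite (_ : (X, Y) + (0, -1) = (X, Y - 1)); last by congr (_, _); rewrite /= addr0.
by rewrite /omega_mul => ->; congr ((_, _), (_, _)) => /=; ring.
Qed.

Lemma mem_third e X Y :
  (e \in walk ((X, Y), (X - 1, Y - 1)) (arms m ++ u ++ arms n ++ v)) =
  [|| e \in walk ((X, Y), (X - 1, Y - 1)) (arms m),
      e \in walk ((X - 3 * m%:Z, Y), (X - 3 * m%:Z - 1, Y - 1)) u,
      e \in walk ((X - 3 * m%:Z + K, Y + L), (X - 3 * m%:Z + K, Y + L - 1)) (arms n)
    | e \in walk ((X - 3 * m%:Z + K - 3 * n%:Z, Y + L - 3 * n%:Z),
                  (X - 3 * m%:Z + K - 3 * n%:Z, Y + L - 3 * n%:Z - 1)) v].
Proof.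
by rewrite !walk_cat !mem_cat walk_end_arms_left walk_end_corner walk_end_arms_down.
Qed.

End Third.

Definition direction (e : eis * eis) : eis := e.2 - e.1.

Lemma directionE (x y x' y' : int) : direction ((x, y), (x', y')) = (x' - x, y' - y).
Proof. by []. Qed.

(** Sorting by direction lets most disjuncts vanish by computation once the direction of the edge is
    known. *)
Lemma mem_left_rows (m : nat) (X Y x y x' y' : int) (j := ((X - x) %/ 3)%Z)
    (d := direction ((x, y), (x', y'))) :
  (((x, y), (x', y')) \in walk ((X, Y), (X - 1, Y - 1)) (arms m)) =
  [|| (d == (-1, -1)) && [&& 0 <= j < m%:Z, x == X - 3 * j & y == Y],
      (d == (-1, 0)) && [&& 0 <= j < m%:Z, x == X - 3 * j - 1 & y == Y - 1],
      (d == (0, 1)) && [&& 0 <= j < m%:Z, x == X - 3 * j - 2 & y == Y - 1]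
    | (d == (-1, 0)) && [&& 0 <= j < m%:Z, x == X - 3 * j - 2 & y == Y]].
Proof.
rewrite mem_arms_left /d /direction !xpair_eqE -/j /=; move: j => j.
by case: (0 <= j < m%:Z) => /=; rewrite ?andbF //; clear; apply/idP/idP; lia.
Qed.

Lemma mem_down_rows (m : nat) (X Y x y x' y' : int) (j := ((X - x) %/ 3)%Z)
    (d := direction ((x, y), (x', y'))) :
  (((x, y), (x', y')) \in walk ((X, Y), (X, Y - 1)) (arms m)) =
  [|| (d == (0, -1)) && [&& 0 <= j < m%:Z, x == X - 3 * j & y == Y - 3 * j],
      (d == (-1, -1)) && [&& 0 <= j < m%:Z, x == X - 3 * j & y == Y - 3 * j - 1],
      (d == (-1, 0)) && [&& 0 <= j < m%:Z, x == X - 3 * j - 1 & y == Y - 3 * j - 2]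
    | (d == (-1, -1)) && [&& 0 <= j < m%:Z, x == X - 3 * j - 2 & y == Y - 3 * j - 2]].
Proof.
rewrite mem_arms_down /d /direction !xpair_eqE -/j /=; move: j => j.
by case: (0 <= j < m%:Z) => /=; rewrite ?andbF //; clear; apply/idP/idP; lia.
Qed.

Definition beyond_upper_sides (a b : int) (al : eis) : bool := (a <= al.2) || (b <= al.2 - al.1).

(* The six sides are permuted by the rotation in two cycles of length 3, represented by the two
   upper sides. *)
Lemma boundary_upper_sides (a b : int) (P : pred (eis * eis)) :
  let B := [set al | in_benzel a b al]%classic in
  (forall e, boundary_edge B e -> beyond_upper_sides a b (right_cell e) -> P e || P (rotate e)) ->
  forall e, boundary_edge B e -> [|| P e, P (rotate e) | P (rotate (rotate e))].
Proof.
move=> B hP e he; have rotB := @rotate_boundary_edge B _.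
have {}rotB f : boundary_edge B (rotate f) <-> boundary_edge B f.
  by apply: rotB => al; rewrite /B /mkset in_benzel_mulomega.
have he1 : boundary_edge B (rotate e) by apply/rotB.
have he2 : boundary_edge B (rotate (rotate e)) by apply/rotB.
have : [|| beyond_upper_sides a b (right_cell e), beyond_upper_sides a b (right_cell (rotate e))
    | beyond_upper_sides a b (right_cell (rotate (rotate e)))].
  case: he => [] {hP he1 he2 rotB}; case: e => -[x y] [x' y'] /grid_adjP[q hq].
  rewrite /B /= /in_benzel /beyond_upper_sides /left_cell /right_cell /rotate /mulomega /lattice /=.
  by clear; lia.
case/or3P => h.
- by case/orP: (hP _ he h) => ->; rewrite ?orbT.
- by case/orP: (hP _ he1 h) => ->; rewrite ?orbT.
- by case/orP: (hP _ he2 h); rewrite ?rotate3 => ->; rewrite ?orbT.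
Qed.

Lemma rotateE (x y x' y' : int) :
  rotate ((x, y), (x', y')) = ((- y, x - y), (- y', x' - y')).
Proof. by []. Qed.

Ltac decide_directions :=
  repeat match goal with |- context [@eq_op ?T (?p, ?q) (?r, ?s)] =>
    first [ change (@eq_op T (p, q) (r, s)) with true
          | change (@eq_op T (p, q) (r, s)) with false] end;
  rewrite ?andTb ?andFb ?orFb ?orbF.

(** For m = 0 the starting edge is the first edge of [u], whence the uniqueness assumption on [u].
    For m > 0 the first period is split off, since [behead] removes only its first edge. *)
Lemma start_once m u r (X Y : int) (e0 := ((X, Y), (X - 1, Y - 1)) : eis * eis)
    (e1 := ((X - 3 * m%:Z, Y), (X - 3 * m%:Z - 1, Y - 1)) : eis * eis) :
  (0 < size u)%N -> uniq (walk ((0, 0), (-1, -1)) u) ->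
  ((0 < m)%N -> e0 \notin walk e1 u) -> e0 \notin walk (walk_end e1 u) r ->
  e0 \notin behead (walk e0 (arms m ++ u ++ r)).
Proof.
rewrite {}/e1; case: m => [|m] u0 uu hu hr.
  rewrite mulr0 subr0 -/e0 in hr; rewrite /= walk_cat.
  have : uniq (walk e0 u).
    by rewrite /e0 translate_left walk_translate map_inj_uniq //; exact: translate_inj.
  case: u u0 {uu hu} hr => [|t u] // _ hr /= /andP[ht _].
  by rewrite mem_cat negb_or ht.
have armE : walk e0 arm = [:: e0; ((X - 1, Y - 1), (X - 2, Y - 1)); ((X - 2, Y - 1), (X - 2, Y));
    ((X - 2, Y), (X - 3, Y))].
  rewrite /e0 /= /step /mulomega /=.
  by do 4?[congr (_ :: _)]; congr ((_, _), (_, _)) => /=; ring.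
have arm_end : walk_end e0 arm = ((X - 3, Y), (X - 3 - 1, Y - 1)).
  by rewrite -[arm]/(arms 1) walk_end_arms_left mulr1.
rewrite -[arms m.+1]/(arm ++ arms m) -catA walk_cat armE arm_end walk_cat walk_end_arms_left.
have -> : X - 3 - 3 * m%:Z = X - 3 * m.+1%:Z by rewrite intS; ring.
have beheadE (f : eis * eis) s t : behead ((f :: s) ++ t) = s ++ t by [].
rewrite walk_cat beheadE !mem_cat (negPf (hu isT)) (negPf hr) !orbF.
rewrite /e0 !in_cons in_nil mem_left_rows directionE !xpair_eqE.
by clear; lia.
Qed.

Lemma rotate2E (x y x' y' : int) : rotate (rotate ((x, y), (x', y'))) =
  ((- (x - y), - y - (x - y)), (- (x' - y'), - y' - (x' - y'))).
Proof. by []. Qed.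

Definition unit_steps (x y dx dy : int) : Prop :=
  ((x + y) %% 3)%Z = 0 /\ (dx = 1 /\ dy = 0 \/ dx = 0 /\ dy = 1 \/ dx = -1 /\ dy = -1) \/
  ((x + y) %% 3)%Z = 1 /\ (dx = -1 /\ dy = 0 \/ dx = 0 /\ dy = -1 \/ dx = 1 /\ dy = 1).

Lemma benzel_boundary_intro a b x y x' y' dx dy : (x' - x, y' - y) = (dx, dy) ->
  unit_steps x y dx dy -> in_benzel a b (x + dx - dy, y + dx) ->
  ~~ in_benzel a b (x + dy, y - dx + dy) ->
  boundary_edge [set al | in_benzel a b al]%classic ((x, y), (x', y')).
Proof.
case=> x'E y'E hd hl /negP hr.
have {x'E} -> : x' = x + dx by rewrite -x'E; ring.
have {y'E} -> : y' = y + dy by rewrite -y'E; ring.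
split.
- by apply/grid_adjP; exists ((x + y) %/ 3)%Z; clear -hd; rewrite /unit_steps in hd; lia.
- suff -> : left_cell ((x, y), (x + dx, y + dy)) = (x + dx - dy, y + dx) by [].
  by rewrite /left_cell /mulomega; congr (_, _) => /=; ring.
- suff -> : right_cell ((x, y), (x + dx, y + dy)) = (x + dy, y - dx + dy) by [].
  by rewrite /right_cell /mulomega; congr (_, _) => /=; ring.
Qed.

Lemma benzel_boundary_elim (P : pred (eis * eis)) a b :
  (forall x y dx dy, unit_steps x y dx dy -> in_benzel a b (x + dx - dy, y + dx) ->
     beyond_upper_sides a b (x + dy, y - dx + dy) ->
     P ((x, y), (x + dx, y + dy))) ->
  forall e, boundary_edge [set al | in_benzel a b al]%classic e ->
    beyond_upper_sides a b (right_cell e) -> P e.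
Proof.
move=> hP [[x y] [x' y']] [/grid_adjP[q hq] hl _ hs].
have x'E : x' = x + (x' - x) by ring.
have y'E : y' = y + (y' - y) by ring.
rewrite x'E y'E; apply: hP.
- by clear -hq; rewrite /unit_steps; lia.
- suff <- : left_cell ((x, y), (x', y')) = (x + (x' - x) - (y' - y), y + (x' - x)) by [].
  by rewrite /left_cell /mulomega; congr (_, _) => /=; ring.
- suff <- : right_cell ((x, y), (x', y')) = (x + (y' - y), y - (x' - x) + (y' - y)) by [].
  by rewrite /right_cell /mulomega; congr (_, _) => /=; ring.
Qed.

Lemma directionD (x y dx dy : int) : direction ((x, y), (x + dx, y + dy)) = (dx, dy).
Proof. by rewrite directionE; congr (_, _); ring. Qed.

Lemma direction_rotateD (x y dx dy : int) :
  direction ((- y, x - y), (- (y + dy), x + dx - (y + dy))) = (- dy, dx - dy).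
Proof. by rewrite directionE; congr (_, _); ring. Qed.

Definition corner_edge (d : eis) (x y : int) (p : eis) (X Y : int) : bool :=
  (d == p) && ((x == X) && (y == Y)).

Ltac solve_sound :=
  let dE := fresh "dE" in let h := fresh "h" in
  rewrite directionE; repeat case/orP; case/andP=> /eqP dE h;
  apply: (benzel_boundary_intro dE); rewrite /unit_steps /in_benzel /lattice /=;
  clear dE; lia.

Ltac prune_disjuncts :=
  repeat match goal with |- context [(?u == ?v) && (?p == ?q)] =>
    rewrite (_ : (u == v) && (p == q) = false); [|by clear; lia] end;
  rewrite ?andbF ?orbF ?orFb.

(* At most two rows of cells meet the outside of each upper side, hence the case analysis on y. *)
Ltac solve_complete x M N M0 N0 a b :=
  let xy := fresh "xy" in let hl := fresh "hl" in
  let hs := fresh "hs" in let hs' := fresh "hs'" in let yE := fresh "yE" in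
  let q := fresh "q" in let s := fresh "s" in let xE := fresh "xE" in let sE := fresh "sE" in
  rewrite /unit_steps => -[] [xy [|[|]]] [-> ->]; decide_directions;
  rewrite /in_benzel /beyond_upper_sides /lattice /=; move=> hl;
  (case: (leP a _) => hs /= hs';
  [ have : y = a \/ y = a - 1 \/ y = a - 2 by clear -hl hs xy M0 N0; lia
  | have : y = x + b \/ y = x + (b - 1) \/ y = x + (b - 2) by clear -hl hs' xy M0 N0; lia ]);
  case=> [yE|[yE|yE]]; rewrite yE in xy hl hs hs' *; clear yE;
  first [by exfalso; clear -hl hs hs' M0 N0; lia | idtac];
  (* The abscissas where the arms start are N - M plus a constant modulo 3; with x written this way
     the quotients that index the periods become affine. *)
  (have [q [s [xE]]] : exists q s, x = 3 * q + s - M + N /\ (s = 0 \/ s = 1 \/ s = 2)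
    by exists ((x + M - N) %/ 3)%Z, ((x + M - N) %% 3)%Z; clear; lia);
  case=> [sE|[sE|sE]]; rewrite xE sE in xy hl hs hs' *; clear xE sE;
  first [by exfalso; clear -xy; lia | clear xy; prune_disjuncts; lia].

(* [w] is the word of a third of the boundary from the top right corner on. *)
Section Class1.

Variables (m n : nat).
Let a : int := m%:Z + 2 * n%:Z + 2.
Let b : int := 2 * m%:Z + n%:Z + 2.
Let w := arms m ++ [:: false; true; true] ++ arms n ++ [:: true].
Let e0 : eis * eis := ((b - 1, a), (b - 1 - 1, a - 1)).

Let walk_corner : walk ((0, 0), (-1, -1)) [:: false; true; true] =
  [:: ((0, 0), (-1, -1)); ((-1, -1), (-2, -1)); ((-2, -1), (-3, -2))].
Proof. by []. Qed.

Let walk_closing : walk ((0, 0), (0, -1)) [:: true] =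
  [:: ((0, 0), (0, -1))].
Proof. by []. Qed.

Let mem_w x y x' y' (d := direction ((x, y), (x', y'))) :
  (((x, y), (x', y')) \in walk e0 w) =
  [|| ((x, y), (x', y')) \in walk e0 (arms m),
      let X := b - 1 - 3 * m%:Z in let Y := a in
      [|| corner_edge d x y (-1, -1) X Y,
          corner_edge d x y (-1, 0) (X - 1) (Y - 1)
        | corner_edge d x y (-1, -1) (X - 2) (Y - 1)],
      ((x, y), (x', y')) \in walk ((b - 1 - 3 * m%:Z - 3, a - 2),
                                  (b - 1 - 3 * m%:Z - 3, a - 2 - 1)) (arms n)
    | let X := b - 1 - 3 * m%:Z - 3 - 3 * n%:Z in let Y := a - 2 - 3 * n%:Z in
      corner_edge d x y (0, -1) X Y].
Proof.
rewrite {}/d directionE /e0 /w (@mem_third _ _ _ _ (-3) (-2)) //; congr [|| _, _, _ | _].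
  rewrite [X in walk X _]translate_left mem_walk_translate walk_corner.
  by rewrite !inE; repeat congr (_ || _); rewrite /corner_edge !xpair_eqE; clear; lia.
rewrite [X in walk X _]translate_down mem_walk_translate walk_closing.
by rewrite !inE; repeat congr (_ || _); rewrite /corner_edge !xpair_eqE; clear; lia.
Qed.

Let sound e : e \in walk e0 w -> boundary_edge [set al | in_benzel a b al]%classic e.
Proof.
case: e => -[x y] [x' y']; rewrite mem_w mem_left_rows mem_down_rows /corner_edge /e0 /=.
rewrite /a /b.
solve_sound.
Qed.

Let complete e : boundary_edge [set al | in_benzel a b al]%classic e ->
  [|| e \in walk e0 w, rotate e \in walk e0 w | rotate (rotate e) \in walk e0 w].
Proof.
apply: (boundary_upper_sides (P := fun e => e \in walk e0 w)) e.
pose P e := (e \in walk e0 w) || (rotate e \in walk e0 w).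
apply: (benzel_boundary_elim (P := P)); rewrite /P.
move=> x y dx dy; rewrite rotateE !mem_w !mem_left_rows !mem_down_rows !directionD.
rewrite !direction_rotateD /corner_edge /=.
rewrite /a /b; move: (m%:Z) (n%:Z) (le0z_nat m) (le0z_nat n) => M N M0 N0.
solve_complete x M N M0 N0 (M + 2 * N + 2) (2 * M + N + 2).
Qed.

Let once : e0 \notin behead (walk e0 w).
Proof.
apply: start_once => //.
  move=> m0; rewrite [X in walk X _]translate_left mem_walk_translate walk_corner.
  by rewrite !inE !xpair_eqE; clear -m0; lia.
rewrite (walk_end_corner (K := -3) (L := -2)) // walk_cat mem_cat walk_end_arms_down.
rewrite mem_down_rows [X in walk X _]translate_down mem_walk_translate walk_closing.
by rewrite !inE directionE !xpair_eqE; clear; lia.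
Qed.

(** The flipped corner turns the second arm of the shadow by -60 degrees relative to the first,
    whence the term - 9 m n in the area of the third. *)
Lemma class1_arms_invariant (R : realType) (A : int) :
  3 * (- 3 - 6 * m%:Z - 3 * n%:Z - 9 * m%:Z * n%:Z) - sqnorm (3 * m%:Z, - 3 - 3 * n%:Z) = 6 * A ->
  Conway_Lagarias_invariant_is [set al | in_benzel a b al]%classic (A%:~R : R).
Proof.
move=> hA; apply: (@invariant_of_third _ _ e0 w A (- 3 - 6 * m%:Z - 3 * n%:Z - 9 * m%:Z * n%:Z)
  (3 * m%:Z, - 3 - 3 * n%:Z)) => //.
- by rewrite /lattice /e0 /a /b /=; clear; lia.
- by apply/grid_adjP; exists ((b - 1 + a) %/ 3)%Z; rewrite /a /b; clear; lia.
- by rewrite !size_cat !size_arms /=; clear; lia.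
- by rewrite !size_cat !size_arms /=; clear; lia.
- rewrite /w !walk_end_cat walk_end_arms_left (walk_end_corner (K := -3) (L := -2)) //.
  rewrite walk_end_arms_down (walk_end_closing (K' := 0) (L' := -1)) //.
  rewrite /rotate /mulomega /a /b.
  by congr ((_, _), (_, _)) => /=; ring.
- by move=> al; rewrite /mkset in_benzel_mulomega.
(* The rotated starting edge has direction 1, which no edge of this third has. Rotated twice it has
   direction omega, found only in the first arms, at another height. *)
- rewrite rotateE mem_w mem_left_rows mem_down_rows /corner_edge; cbv zeta.
  rewrite (_ : direction _ = (1, 0)); last by rewrite directionE; congr (_, _); ring.
  by decide_directions; rewrite /a /b; clear; lia.
- rewrite rotate2E mem_w mem_left_rows mem_down_rows /corner_edge; cbv zeta.
  rewrite (_ : direction _ = (0, 1)); last by rewrite directionE; congr (_, _); ring.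
  by decide_directions; rewrite /a /b; clear; lia.
have arms_even k : odd (size (arms k)) = false by rewrite size_arms oddM.
(* The corner word has odd length, so the second arms and the closing word are read in the opposite
   phase. *)
have uE : motion (alternate false [:: false; true; true]) =
    ((0, -2), (0, -1), -3) by [].
have vE : motion (alternate true [:: true]) =
    ((1, 0), (0, -1), 0) by [].
rewrite /w alternate_cat arms_even addbF alternate_cat (_ : false (+) _ = true) //.
rewrite alternate_cat arms_even addbF !motion_cat !motion_alternate_arms uE vE.
rewrite /compose_motion /omega_mul /cross /sqnorm; congr ((_, _), (_, _), _) => /=; ring.
Qed.

End Class1.

(** * Class 0: 2b - a = 3m + 3 and 2a - b = 3n + 3 *)

Section Class0.

Variables (m n : nat).
Let a : int := m%:Z + 2 * n%:Z + 3.
Let b : int := 2 * m%:Z + n%:Z + 3.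
Let w := arms m ++ [:: true] ++ arms n ++ [:: false; true; false; true; true].
Let e0 : eis * eis := ((b - 3, a), (b - 3 - 1, a - 1)).

Let walk_corner : walk ((0, 0), (-1, -1)) [:: true] =
  [:: ((0, 0), (-1, -1))].
Proof. by []. Qed.

Let walk_closing : walk ((0, 0), (0, -1)) [:: false; true; false; true; true] =
  [:: ((0, 0), (0, -1));
      ((0, -1), (-1, -2));
      ((-1, -2), (-1, -3));
      ((-1, -3), (-2, -4));
      ((-2, -4), (-2, -5))].
Proof. by []. Qed.

Let mem_w x y x' y' (d := direction ((x, y), (x', y'))) :
  (((x, y), (x', y')) \in walk e0 w) =
  [|| ((x, y), (x', y')) \in walk e0 (arms m),
      let X := b - 3 - 3 * m%:Z in let Y := a in
      corner_edge d x y (-1, -1) X Y,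
      ((x, y), (x', y')) \in walk ((b - 3 - 3 * m%:Z - 1, a - 1),
                                  (b - 3 - 3 * m%:Z - 1, a - 1 - 1)) (arms n)
    | let X := b - 3 - 3 * m%:Z - 1 - 3 * n%:Z in let Y := a - 1 - 3 * n%:Z in
      [|| corner_edge d x y (0, -1) X Y,
          corner_edge d x y (-1, -1) X (Y - 1),
          corner_edge d x y (0, -1) (X - 1) (Y - 2),
          corner_edge d x y (-1, -1) (X - 1) (Y - 3)
        | corner_edge d x y (0, -1) (X - 2) (Y - 4)]].
Proof.
rewrite {}/d directionE /e0 /w (@mem_third _ _ _ _ (-1) (-1)) //; congr [|| _, _, _ | _].
  rewrite [X in walk X _]translate_left mem_walk_translate walk_corner.
  by rewrite !inE; repeat congr (_ || _); rewrite /corner_edge !xpair_eqE; clear; lia.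
rewrite [X in walk X _]translate_down mem_walk_translate walk_closing.
by rewrite !inE; repeat congr (_ || _); rewrite /corner_edge !xpair_eqE; clear; lia.
Qed.

Let sound e : e \in walk e0 w -> boundary_edge [set al | in_benzel a b al]%classic e.
Proof.
case: e => -[x y] [x' y']; rewrite mem_w mem_left_rows mem_down_rows /corner_edge /e0 /=.
rewrite /a /b.
solve_sound.
Qed.

Let complete e : boundary_edge [set al | in_benzel a b al]%classic e ->
  [|| e \in walk e0 w, rotate e \in walk e0 w | rotate (rotate e) \in walk e0 w].
Proof.
apply: (boundary_upper_sides (P := fun e => e \in walk e0 w)) e.
pose P e := (e \in walk e0 w) || (rotate e \in walk e0 w).
apply: (benzel_boundary_elim (P := P)); rewrite /P.
move=> x y dx dy; rewrite rotateE !mem_w !mem_left_rows !mem_down_rows !directionD.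
rewrite !direction_rotateD /corner_edge /=.
rewrite /a /b; move: (m%:Z) (n%:Z) (le0z_nat m) (le0z_nat n) => M N M0 N0.
solve_complete x M N M0 N0 (M + 2 * N + 3) (2 * M + N + 3).
Qed.

Let once : e0 \notin behead (walk e0 w).
Proof.
apply: start_once => //.
  move=> m0; rewrite [X in walk X _]translate_left mem_walk_translate walk_corner.
  by rewrite !inE !xpair_eqE; clear -m0; lia.
rewrite (walk_end_corner (K := -1) (L := -1)) // walk_cat mem_cat walk_end_arms_down.
rewrite mem_down_rows [X in walk X _]translate_down mem_walk_translate walk_closing.
by rewrite !inE directionE !xpair_eqE; clear; lia.
Qed.

(** Here the two arms of the shadow make an angle of +60 degrees, whence + 9 m n. *)
Lemma class0_arms_invariant (R : realType) (A : int) :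
  3 * (6 + 3 * n%:Z + 3 * m%:Z + 9 * m%:Z * n%:Z) - sqnorm (3 * m%:Z + 3 * n%:Z, 3 * n%:Z) = 6 * A ->
  Conway_Lagarias_invariant_is [set al | in_benzel a b al]%classic (A%:~R : R).
Proof.
move=> hA; apply: (@invariant_of_third _ _ e0 w A (6 + 3 * n%:Z + 3 * m%:Z + 9 * m%:Z * n%:Z)
  (3 * m%:Z + 3 * n%:Z, 3 * n%:Z)) => //.
- by rewrite /lattice /e0 /a /b /=; clear; lia.
- by apply/grid_adjP; exists ((b - 3 + a) %/ 3)%Z; rewrite /a /b; clear; lia.
- by rewrite !size_cat !size_arms /=; clear; lia.
- by rewrite !size_cat !size_arms /=; clear; lia.
- rewrite /w !walk_end_cat walk_end_arms_left (walk_end_corner (K := -1) (L := -1)) //.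
  rewrite walk_end_arms_down (walk_end_closing (K' := -2) (L' := -5)) //.
  rewrite /rotate /mulomega /a /b.
  by congr ((_, _), (_, _)) => /=; ring.
- by move=> al; rewrite /mkset in_benzel_mulomega.
- rewrite rotateE mem_w mem_left_rows mem_down_rows /corner_edge; cbv zeta.
  rewrite (_ : direction _ = (1, 0)); last by rewrite directionE; congr (_, _); ring.
  by decide_directions; rewrite /a /b; clear; lia.
- rewrite rotate2E mem_w mem_left_rows mem_down_rows /corner_edge; cbv zeta.
  rewrite (_ : direction _ = (0, 1)); last by rewrite directionE; congr (_, _); ring.
  by decide_directions; rewrite /a /b; clear; lia.
have arms_even k : odd (size (arms k)) = false by rewrite size_arms oddM.
have uE : motion (alternate false [:: true]) =
    ((1, 0), (1, 1), 0) by [].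
have vE : motion (alternate true [:: false; true; false; true; true]) =
    ((0, 1), (-1, 0), 6) by [].
rewrite /w alternate_cat arms_even addbF alternate_cat (_ : false (+) _ = true) //.
rewrite alternate_cat arms_even addbF !motion_cat !motion_alternate_arms uE vE.
rewrite /compose_motion /omega_mul /cross /sqnorm; congr ((_, _), (_, _), _) => /=; ring.
Qed.

End Class0.

(** * Class -1, as residue 2: 2b - a = 3m + 4 and 2a - b = 3n + 4 *)

Section Class2.

Variables (m n : nat).
Let a : int := m%:Z + 2 * n%:Z + 4.
Let b : int := 2 * m%:Z + n%:Z + 4.
Let w := arms m ++ [:: false; true; false; true; true] ++ arms n ++ [:: false; true; true].
Let e0 : eis * eis := ((b - 2, a), (b - 2 - 1, a - 1)).

Let walk_corner : walk ((0, 0), (-1, -1)) [:: false; true; false; true; true] =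
  [:: ((0, 0), (-1, -1));
      ((-1, -1), (-2, -1));
      ((-2, -1), (-3, -2));
      ((-3, -2), (-4, -2));
      ((-4, -2), (-5, -3))].
Proof. by []. Qed.

Let walk_closing : walk ((0, 0), (0, -1)) [:: false; true; true] =
  [:: ((0, 0), (0, -1)); ((0, -1), (-1, -2)); ((-1, -2), (-1, -3))].
Proof. by []. Qed.

Let mem_w x y x' y' (d := direction ((x, y), (x', y'))) :
  (((x, y), (x', y')) \in walk e0 w) =
  [|| ((x, y), (x', y')) \in walk e0 (arms m),
      let X := b - 2 - 3 * m%:Z in let Y := a in
      [|| corner_edge d x y (-1, -1) X Y,
          corner_edge d x y (-1, 0) (X - 1) (Y - 1),
          corner_edge d x y (-1, -1) (X - 2) (Y - 1),
          corner_edge d x y (-1, 0) (X - 3) (Y - 2)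
        | corner_edge d x y (-1, -1) (X - 4) (Y - 2)],
      ((x, y), (x', y')) \in walk ((b - 2 - 3 * m%:Z - 5, a - 3),
                                  (b - 2 - 3 * m%:Z - 5, a - 3 - 1)) (arms n)
    | let X := b - 2 - 3 * m%:Z - 5 - 3 * n%:Z in let Y := a - 3 - 3 * n%:Z in
      [|| corner_edge d x y (0, -1) X Y,
          corner_edge d x y (-1, -1) X (Y - 1)
        | corner_edge d x y (0, -1) (X - 1) (Y - 2)]].
Proof.
rewrite {}/d directionE /e0 /w (@mem_third _ _ _ _ (-5) (-3)) //; congr [|| _, _, _ | _].
  rewrite [X in walk X _]translate_left mem_walk_translate walk_corner.
  by rewrite !inE; repeat congr (_ || _); rewrite /corner_edge !xpair_eqE; clear; lia.
rewrite [X in walk X _]translate_down mem_walk_translate walk_closing.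
by rewrite !inE; repeat congr (_ || _); rewrite /corner_edge !xpair_eqE; clear; lia.
Qed.

Let sound e : e \in walk e0 w -> boundary_edge [set al | in_benzel a b al]%classic e.
Proof.
case: e => -[x y] [x' y']; rewrite mem_w mem_left_rows mem_down_rows /corner_edge /e0 /=.
rewrite /a /b.
solve_sound.
Qed.

Let complete e : boundary_edge [set al | in_benzel a b al]%classic e ->
  [|| e \in walk e0 w, rotate e \in walk e0 w | rotate (rotate e) \in walk e0 w].
Proof.
apply: (boundary_upper_sides (P := fun e => e \in walk e0 w)) e.
pose P e := (e \in walk e0 w) || (rotate e \in walk e0 w).
apply: (benzel_boundary_elim (P := P)); rewrite /P.
move=> x y dx dy; rewrite rotateE !mem_w !mem_left_rows !mem_down_rows !directionD.
rewrite !direction_rotateD /corner_edge /=.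
rewrite /a /b; move: (m%:Z) (n%:Z) (le0z_nat m) (le0z_nat n) => M N M0 N0.
solve_complete x M N M0 N0 (M + 2 * N + 4) (2 * M + N + 4).
Qed.

Let once : e0 \notin behead (walk e0 w).
Proof.
apply: start_once => //.
  move=> m0; rewrite [X in walk X _]translate_left mem_walk_translate walk_corner.
  by rewrite !inE !xpair_eqE; clear -m0; lia.
rewrite (walk_end_corner (K := -5) (L := -3)) // walk_cat mem_cat walk_end_arms_down.
rewrite mem_down_rows [X in walk X _]translate_down mem_walk_translate walk_closing.
by rewrite !inE directionE !xpair_eqE; clear; lia.
Qed.

(** The flipped corner reverses the direction: the arms of the shadow are antiparallel, so the area
    of the third has no term in m n. *)
Lemma class2_arms_invariant (R : realType) (A : int) :
  3 * (- 3 - 6 * m%:Z) - sqnorm (3 * m%:Z - 3 * n%:Z - 3, - 3) = 6 * A ->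
  Conway_Lagarias_invariant_is [set al | in_benzel a b al]%classic (A%:~R : R).
Proof.
move=> hA; apply: (@invariant_of_third _ _ e0 w A (- 3 - 6 * m%:Z)
  (3 * m%:Z - 3 * n%:Z - 3, - 3)) => //.
- by rewrite /lattice /e0 /a /b /=; clear; lia.
- by apply/grid_adjP; exists ((b - 2 + a) %/ 3)%Z; rewrite /a /b; clear; lia.
- by rewrite !size_cat !size_arms /=; clear; lia.
- by rewrite !size_cat !size_arms /=; clear; lia.
- rewrite /w !walk_end_cat walk_end_arms_left (walk_end_corner (K := -5) (L := -3)) //.
  rewrite walk_end_arms_down (walk_end_closing (K' := -1) (L' := -3)) //.
  rewrite /rotate /mulomega /a /b.
  by congr ((_, _), (_, _)) => /=; ring.
- by move=> al; rewrite /mkset in_benzel_mulomega.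
- rewrite rotateE mem_w mem_left_rows mem_down_rows /corner_edge; cbv zeta.
  rewrite (_ : direction _ = (1, 0)); last by rewrite directionE; congr (_, _); ring.
  by decide_directions; rewrite /a /b; clear; lia.
- rewrite rotate2E mem_w mem_left_rows mem_down_rows /corner_edge; cbv zeta.
  rewrite (_ : direction _ = (0, 1)); last by rewrite directionE; congr (_, _); ring.
  by decide_directions; rewrite /a /b; clear; lia.
have arms_even k : odd (size (arms k)) = false by rewrite size_arms oddM.
have uE : motion (alternate false [:: false; true; false; true; true]) =
    ((-1, -1), (-1, 0), -6) by [].
have vE : motion (alternate true [:: false; true; true]) =
    ((2, 2), (1, 1), 3) by [].
rewrite /w alternate_cat arms_even addbF alternate_cat (_ : false (+) _ = true) //.
rewrite alternate_cat arms_even addbF !motion_cat !motion_alternate_arms uE vE.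
rewrite /compose_motion /omega_mul /cross /sqnorm; congr ((_, _), (_, _), _) => /=; ring.
Qed.

End Class2.

(** * From arm lengths back to a and b *)

Section Classes.

Variable R : realType.
Implicit Types a b : int.

Lemma benzel_set a b : 2 <= a <= 2 * b -> 2 <= b <= 2 * a ->
  benzel R a b = [set al | in_benzel a b al]%classic.
Proof.
move=> ha hb; apply/seteqP.
have h (x y : int) : benzel R a b (x, y) <->
    [/\ lattice (-1) (x, y), - a < x < b, - b < y < a & - a < y - x < b].
  by apply: benzelE; lia.
split=> -[x y]; first by move=> /h[h1 h2 h3 h4]; rewrite /in_benzel /= h1 h2 h3 h4.
by move=> /and4P[h1 h2 h3 h4]; apply/h.
Qed.

Lemma half_mulz (v A : int) : v = 2 * A -> v%:~R / 2 = A%:~R :> R.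
Proof. by move=> ->; rewrite rmorphM /= mulrC mulKf // pnatr_eq0. Qed.

(** Provides the integer value of the halved quadratic expressions, whose odd part is a combination
    of products p (p + 1). *)
Lemma triangular (p : int) : exists k, p * (p + 1) = 2 * k.
Proof.
have [k [->|->]] : exists k, p = 2 * k \/ p = 2 * k + 1 by exists (p %/ 2)%Z; lia.
  by exists (k * (2 * k + 1)); ring.
by exists ((2 * k + 1) * (k + 1)); ring.
Qed.

Lemma invariant_class1 a b : 2 <= a <= 2 * b -> 2 <= b <= 2 * a -> ((a + b) %% 3)%Z = 1 ->
  Conway_Lagarias_invariant_is [set al | in_benzel a b al]%classic
    ((a ^+ 2 - 4 * a * b + b ^+ 2 + a + b - 2)%:~R / 2 : R).
Proof.
move=> ha hb hab.
(* Both 2b - a and 2a - b are 2 modulo 3 and nonnegative, hence at least 2: class 1 has no extreme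
   case. *)
pose m := absz ((2 * b - a - 2) %/ 3)%Z; pose n := absz ((2 * a - b - 2) %/ 3)%Z.
have aE : a = m%:Z + 2 * n%:Z + 2 by rewrite /m /n; lia.
have bE : b = 2 * m%:Z + n%:Z + 2 by rewrite /m /n; lia.
have [k kE] := triangular m; have [l lE] := triangular n.
rewrite (@half_mulz _ (- 3 * k - 3 * m%:Z - 6 * m%:Z * n%:Z - 3 * l - 3 * n%:Z - 3)).
  rewrite aE bE; apply: class1_arms_invariant; rewrite /sqnorm /=.
  move: kE lE; move: (m%:Z) (n%:Z) => M N kE lE.
  apply: (@mulfI _ 2) => //.
  transitivity (- 18 * (M * (M + 1)) - 36 * M - 72 * M * N - 18 * (N * (N + 1)) - 36 * N - 36).
    by ring.
  by rewrite kE lE; ring.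
rewrite aE bE; move: kE lE; move: (m%:Z) (n%:Z) => M N kE lE.
transitivity (- 3 * (M * (M + 1)) - 6 * M - 12 * M * N - 3 * (N * (N + 1)) - 6 * N - 6).
  by ring.
by rewrite kE lE; ring.
Qed.

(** Both 2b - a and 2a - b are multiples of 3, so each is 0 or at least the 3 that the corners
    need. *)
Lemma invariant_class0 a b : 2 <= a <= 2 * b -> 2 <= b <= 2 * a -> ((a + b) %% 3)%Z = 0 ->
  Conway_Lagarias_invariant_is [set al | in_benzel a b al]%classic
    ((- 3 * a ^+ 2 + 6 * a * b - 3 * b ^+ 2 + a + b)%:~R / 2 : R).
Proof.
move=> ha hb hab.
(* In the two extreme cases the benzel is also a benzel of class 1. *)
have [aE|[bE|[ab ba]]] : a = 2 * b \/ b = 2 * a \/ a <= 2 * b - 3 /\ b <= 2 * a - 3 by lia.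
- rewrite (_ : [set al | in_benzel a b al]%classic =
    [set al | in_benzel (2 * b - 2) b al]%classic); last first.
    apply/seteqP; rewrite aE in ha hb hab *.
    by split=> -[x y]; rewrite /in_benzel /lattice /=; lia.
  rewrite (_ : - 3 * a ^+ 2 + 6 * a * b - 3 * b ^+ 2 + a + b =
    (2 * b - 2) ^+ 2 - 4 * (2 * b - 2) * b + b ^+ 2 + (2 * b - 2) + b - 2); last by rewrite aE; ring.
  by apply: invariant_class1; lia.
- rewrite (_ : [set al | in_benzel a b al]%classic =
    [set al | in_benzel a (2 * a - 2) al]%classic); last first.
    apply/seteqP; rewrite bE in ha hb hab *.
    by split=> -[x y]; rewrite /in_benzel /lattice /=; lia.
  rewrite (_ : - 3 * a ^+ 2 + 6 * a * b - 3 * b ^+ 2 + a + b =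
    a ^+ 2 - 4 * a * (2 * a - 2) + (2 * a - 2) ^+ 2 + a + (2 * a - 2) - 2); last by rewrite bE; ring.
  by apply: invariant_class1; lia.
pose m := absz ((2 * b - a - 3) %/ 3)%Z; pose n := absz ((2 * a - b - 3) %/ 3)%Z.
have aE : a = m%:Z + 2 * n%:Z + 3 by rewrite /m /n; lia.
have bE : b = 2 * m%:Z + n%:Z + 3 by rewrite /m /n; lia.
have [k kE] := triangular m; have [l lE] := triangular n.
rewrite (@half_mulz _ (3 + 3 * m%:Z * n%:Z - 3 * k + 3 * m%:Z - 3 * l + 3 * n%:Z)).
  rewrite aE bE; apply: class0_arms_invariant; rewrite /sqnorm /=.
  move: kE lE; move: (m%:Z) (n%:Z) => M N kE lE.
  apply: (@mulfI _ 2) => //.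
  transitivity (36 + 36 * M * N - 18 * (M * (M + 1)) - 18 * (N * (N + 1)) + 36 * M + 36 * N).
    by ring.
  by rewrite kE lE; ring.
rewrite aE bE; move: kE lE; move: (m%:Z) (n%:Z) => M N kE lE.
transitivity (6 + 6 * M * N - 3 * (M * (M + 1)) - 3 * (N * (N + 1)) + 6 * M + 6 * N).
  by ring.
by rewrite kE lE; ring.
Qed.

Lemma invariant_class2 a b : 2 <= a <= 2 * b -> 2 <= b <= 2 * a -> ((a + b) %% 3)%Z = 2 ->
  Conway_Lagarias_invariant_is [set al | in_benzel a b al]%classic
    ((- 3 * a ^+ 2 + 6 * a * b - 3 * b ^+ 2 - a - b + 2)%:~R / 2 : R).
Proof.
move=> ha hb hab.
(* Both side lengths are 1 modulo 3. Length 1 is too short for the corners, and the benzel is then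
   also one of class 1; otherwise the length is at least 4. *)
have [aE|[bE|[ab ba]]] : a = 2 * b - 1 \/ b = 2 * a - 1 \/ a <= 2 * b - 4 /\ b <= 2 * a - 4.
  by lia.
- rewrite (_ : [set al | in_benzel a b al]%classic =
    [set al | in_benzel (2 * b - 2) b al]%classic); last first.
    apply/seteqP; rewrite aE in ha hb hab *.
    by split=> -[x y]; rewrite /in_benzel /lattice /=; lia.
  rewrite (_ : - 3 * a ^+ 2 + 6 * a * b - 3 * b ^+ 2 - a - b + 2 =
    (2 * b - 2) ^+ 2 - 4 * (2 * b - 2) * b + b ^+ 2 + (2 * b - 2) + b - 2); last by rewrite aE; ring.
  by apply: invariant_class1; lia.
- rewrite (_ : [set al | in_benzel a b al]%classic =
    [set al | in_benzel a (2 * a - 2) al]%classic); last first.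
    apply/seteqP; rewrite bE in ha hb hab *.
    by split=> -[x y]; rewrite /in_benzel /lattice /=; lia.
  rewrite (_ : - 3 * a ^+ 2 + 6 * a * b - 3 * b ^+ 2 - a - b + 2 =
    a ^+ 2 - 4 * a * (2 * a - 2) + (2 * a - 2) ^+ 2 + a + (2 * a - 2) - 2); last by rewrite bE; ring.
  by apply: invariant_class1; lia.
pose m := absz ((2 * b - a - 4) %/ 3)%Z; pose n := absz ((2 * a - b - 4) %/ 3)%Z.
have aE : a = m%:Z + 2 * n%:Z + 4 by rewrite /m /n; lia.
have bE : b = 2 * m%:Z + n%:Z + 4 by rewrite /m /n; lia.
(* The antiparallel arms make the quadratic part depend on m - n only. *)
have [k kE] := triangular (m%:Z - n%:Z - 1).
rewrite (@half_mulz _ (- 3 - 3 * m%:Z - 3 * k)).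
  rewrite aE bE; apply: class2_arms_invariant; rewrite /sqnorm /=.
  move: kE; move: (m%:Z) (n%:Z) => M N kE.
  apply: (@mulfI _ 2) => //.
  transitivity (- 36 - 36 * M - 18 * ((M - N - 1) * (M - N - 1 + 1))); first by ring.
  by rewrite kE; ring.
rewrite aE bE; move: kE; move: (m%:Z) (n%:Z) => M N kE.
transitivity (- 6 - 6 * M - 3 * ((M - N - 1) * (M - N - 1 + 1))); first by ring.
by rewrite kE; ring.
Qed.

End Classes.

Theorem theorem2 (R : realType) (a b c : int)
  (ha : 2 <= a <= 2 * b) (hb : 2 <= b <= 2 * a)
  (hc : c \in [:: 0; 1; -1]) (habc : (c = a + b %[mod 3])%Z) :
  Conway_Lagarias_invariant_is (benzel R a b)
    (if c == 0 then
       (- 3 * a ^+ 2 + 6 * a * b - 3 * b ^+ 2 + a + b)%:~R / 2 : R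
     else if c == 1 then
       (a ^+ 2 - 4 * a * b + b ^+ 2 + a + b - 2)%:~R / 2
     else
       (- 3 * a ^+ 2 + 6 * a * b - 3 * b ^+ 2 - a - b + 2)%:~R / 2).
Proof.
rewrite benzel_set //; move: hc habc.
rewrite !inE => /or3P[] /eqP -> /= habc.
- by apply: invariant_class0 => //; lia.
- by apply: invariant_class1 => //; lia.
- by apply: invariant_class2 => //; lia.
Qed.
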